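(* The algebra homomorphisms $\widetilde{\mathrm{BK}}:\widehat{\mathrm Y}^\Lambda_{d,n}(q)\to\mathrm H_n^\Lambda(\Gamma)$, $\mathrm{JPA}$, $\mathrm{BK}$ and $\Phi_n^\Lambda$ satisfy $$\widetilde{\mathrm{BK}}=\Phi_n^\Lambda\circ\mathrm{BK}\circ\mathrm{JPA},$$ i.e. the diagram formed by $$\widehat{\mathrm Y}^\Lambda_{d,n}(q)\xrightarrow{\ \mathrm{JPA}\ }\bigoplus_\lambda\mathrm{Mat}_{m_\lambda}\widehat{\mathrm H}^\Lambda_\lambda(q)\xrightarrow{\ \mathrm{BK}\ }\bigoplus_\lambda\mathrm{Mat}_{m_\lambda}\mathrm H^\Lambda_\lambda(\Gamma)\xrightarrow{\ \Phi^\Lambda_n\ }\mathrm H^\Lambda_n(\Gamma)$$ and $\widetilde{\mathrm{BK}}$ commutes.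
   Context: **Setup.** $d,n\ge1$, $e\ge2$ integers; the base field is $\mathbb C$; $\xi\in\mathbb C$ is a primitive $d$-th root of unity, $q\in\mathbb C^\times$ a primitive $e$-th root of unity, $\sqrt q$ a fixed square root. $I=\mathbb Z/e\mathbb Z$, $J=\mathbb Z/d\mathbb Z\simeq\{1,\dots,d\}$, $K=I\times J$, $\mathcal K_j=I\times\{j\}$. $\Lambda=(\Lambda_i)_{i\in I}$ is a tuple of non-negative integers, not all $0$; $\Lambda_{(i,j)}:=\Lambda_i$. $\mathfrak S_n$ acts on $n$-tuples by $\sigma\cdot(x_1,\dots,x_n)=(x_{\sigma^{-1}(1)},\dots)$, $s_a=(a,a+1)$. Elements $k\in K^n$ are written $k=(i,j)$, $k_a=(i_a,j_a)$. **Yokonuma–Hecke side.** $\widehat{\mathrm Y}^\Lambda_{d,n}(q)$ is the unital $\mathbb C$-algebra generated by $g_1,\dots,g_{n-1},t_1,\dots,t_n,X_1$ with relations $t_a^d=1$, $t_at_b=t_bt_a$, $t_bg_a=g_at_{s_a(b)}$, $g_a^2=q+(q-1)g_ae_a$ with $e_a=\frac1d\sum_{j\in J}t_a^jt_{a+1}^{-j}$, $g_ag_b=g_bg_a$ if $|a-b|>1$, $g_{a+1}g_ag_{a+1}=g_ag_{a+1}g_a$, $X_1g_1X_1g_1=g_1X_1g_1X_1$, $X_1g_a=g_aX_1$ ($a>1$), $X_1t_b=t_bX_1$, $\prod_{i\in I}(X_1-q^i)^{\Lambda_i}=0$. Put $qX_{a+1}=g_aX_ag_a$. For $d=1$ (with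 $n$ replaced by $m$) this is the cyclotomic Hecke algebra $\widehat{\mathrm H}^\Lambda_m(q)$, generated by $g_1,\dots,g_{m-1},X_1$. For a $d$-composition $\lambda$ of $n$ (tuple of $d$ non-negative integers with sum $n$), $\widehat{\mathrm H}^\Lambda_\lambda(q)=\bigotimes_{j=1}^d\widehat{\mathrm H}^\Lambda_{\lambda_j}(q)$, where the generators $g_a,X_a$ of the $j$-th factor are reindexed by shifting indices by $\lambda_1+\dots+\lambda_{j-1}$. **Quiver Hecke side.** For a quiver $G$ (finite vertex set $V$, no loops or multiple edges) with weights $\Lambda_v$, write $v\to v'$ if $(v,v')$ is an edge and $(v',v)$ is not, $v\leftarrow v'$ if $v'\to v$, $v\leftrightarrows v'$ if both are edges, $v\not\!-\,v'$ if $v\ne v'$ and neither is. $\mathrm H^\Lambda_m(G)$ is the unital $\mathbb C$-algebra generated by $e(k)$ ($k\in V^m$), $y_1,\dots,y_m,\psi_1,\dots,\psi_{m-1}$ with relations: $\sum_ke(k)=1$; $e(k)e(k')=\delta_{k,k'}e(k)$; $y_ae(k)=e(k)y_a$; $\psi_ae(k)=e(s_a\cdot k)\psi_a$; $y_ay_b=y_by_a$; $\psi_ay_b=y_b\psi_a$ if $b\ne a,a+1$; $\psi_a\psi_b=\psi_b\psi_a$ if $|a-b|>1$; $\psi_ay_{a+1}e(k)=(y_a\psi_a+\delta_{k_a,k_{a+1}})e(k)$; $y_{a+1}\psi_ae(k)=(\psi_ay_a+\delta_{k_a,k_{a+1}})e(k)$; $\psi_a^2e(k)$ equals $0$ if $k_a=k_{a+1}$,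 $e(k)$ if $k_a\not\!-\,k_{a+1}$, $(y_{a+1}-y_a)e(k)$ if $k_a\to k_{a+1}$, $(y_a-y_{a+1})e(k)$ if $k_a\leftarrow k_{a+1}$, $(y_{a+1}-y_a)(y_a-y_{a+1})e(k)$ if $k_a\leftrightarrows k_{a+1}$; $\psi_{a+1}\psi_a\psi_{a+1}e(k)=(\psi_a\psi_{a+1}\psi_a+c)e(k)$ with $c=-1,\,1,\,2y_{a+1}-y_a-y_{a+2}$ according as $k_{a+2}=k_a\to k_{a+1}$, $k_{a+2}=k_a\leftarrow k_{a+1}$, $k_{a+2}=k_a\leftrightarrows k_{a+1}$, and $c=0$ otherwise; $y_1^{\Lambda_{k_1}}e(k)=0$. The $y_a$ are nilpotent. $\Gamma_e$ is the quiver with vertex set $I$ and edges $i\to i+1$ ($i\in I$); $\Gamma$ has vertex set $K$ and an edge from $(i,j)$ to $(i+1,j)$ for each $(i,j)\in K$. $\mathrm H^\Lambda_\lambda(\Gamma)=\bigotimes_{j=1}^d\mathrm H^\Lambda_{\lambda_j}(\Gamma_e)$, with the $j$-th factor having vertex set $\mathcal K_j\simeq I$ and its indices shifted by $\lambda_1+\dots+\lambda_{j-1}$. **Power series.** Put $y_a(i)=q^{i_a}(1-y_a)$. For $k=(i,j)$: if $j_a=j_{a+1}$ (always the case for $d=1$), $Q_a(k)$ equals $1-q+qy_{a+1}-y_a$ if $i_a=i_{a+1}$; $\frac{y_a(i)-qy_{a+1}(i)}{y_a(i)-y_{a+1}(i)}$ if $i_a\not\!-\,i_{a+1}$; $\frac{y_a(i)-qy_{a+1}(i)}{(y_a(i)-y_{a+1}(i))^2}$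 if $i_a\to i_{a+1}$; $q^{i_a}$ if $i_a\leftarrow i_{a+1}$; $\frac{q^{i_a}}{y_a(i)-y_{a+1}(i)}$ if $i_a\leftrightarrows i_{a+1}$ (arrows in $\Gamma_e$); and $P_a(k)$ equals $1$ if $i_a=i_{a+1}$, $(1-q)(1-y_a(i)y_{a+1}(i)^{-1})^{-1}$ if $i_a\ne i_{a+1}$. If $j_a\ne j_{a+1}$: $Q_a(k)=\sqrt q$, $P_a(k)=0$. **Maps** (all are known to be algebra isomorphisms). $\widetilde{\mathrm{BK}}(g_a)=\sum_{k\in K^n}(\psi_aQ_a(k)-P_a(k))e(k)$, $\widetilde{\mathrm{BK}}(t_a)=\sum_{k=(i,j)\in K^n}\xi^{j_a}e(k)$, $\widetilde{\mathrm{BK}}(X_a)=\sum_{k=(i,j)\in K^n}q^{i_a}(1-y_a)e(k)$. The case $d=1$ of these formulas gives $\widehat{\mathrm H}^\Lambda_m(q)\to\mathrm H^\Lambda_m(\Gamma_e)$ (the Brundan–Kleshchev isomorphism); $\mathrm{BK}$ is the map it induces on tensor products and entrywise on matrices. For a $d$-composition $\lambda$ of $n$: $m_\lambda=\frac{n!}{\lambda_1!\cdots\lambda_d!}$; $J^\lambda\subseteq J^n$ is the set of $\mathfrak t$ in which each $j$ occurs $\lambda_j$ times; rows and columns of $\mathrm{Mat}_{m_\lambda}$ are indexed by $J^\lambda$, with elementary matrices $E_{\mathfrak t',\mathfrak t}$; $\mathfrak t^\lambda=(1,\dots,1,\dots,d,\dots,d)\in J^\lambda$; $\pi_{\mathfrak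 t}\in\mathfrak S_n$ is the unique element of minimal length with $\pi_{\mathfrak t}\cdot\mathfrak t=\mathfrak t^\lambda$ ($\mathfrak t\in J^\lambda$). $\mathrm{JPA}(t_a)=\sum_{\mathfrak t\in J^n}\xi^{\mathfrak t_a}E_{\mathfrak t,\mathfrak t}$, $\mathrm{JPA}(X_a)=\sum_{\mathfrak t\in J^n}X_{\pi_{\mathfrak t}(a)}E_{\mathfrak t,\mathfrak t}$, $\mathrm{JPA}(g_a)=\sum_{\mathfrak t_a=\mathfrak t_{a+1}}g_{\pi_{\mathfrak t}(a)}E_{\mathfrak t,\mathfrak t}+\sum_{\mathfrak t_a\ne\mathfrak t_{a+1}}\sqrt q\,E_{\mathfrak t,s_a\cdot\mathfrak t}$. $\Phi^\Lambda_n$ is given by $\Phi^\Lambda_n(vE_{\mathfrak t',\mathfrak t})=\psi_{\pi_{\mathfrak t'}^{-1}}\,v\,\psi_{\pi_{\mathfrak t}}$ for $v\in\mathrm H_\lambda^\Lambda(\Gamma)$, $\mathfrak t,\mathfrak t'\in J^\lambda$, where $\psi_w=\psi_{a_1}\cdots\psi_{a_r}$ for a chosen reduced expression $w=s_{a_1}\cdots s_{a_r}$ and $v$ is viewed in $e(\mathfrak t^\lambda)\mathrm H^\Lambda_n(\Gamma)e(\mathfrak t^\lambda)$, $e(\mathfrak t^\lambda)=\sum_{k=(i,j),\,j=\mathfrak t^\lambda}e(k)$, via (shifted) generators $y_a\mapsto y_ae(\mathfrak t^\lambda)$, $\psi_a\mapsto\psi_ae(\mathfrak t^\lambda)$, $e(k^1)\otimes\cdots\otimes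 e(k^d)\mapsto e(k)$, $k$ the concatenation. *)

(* Defs.v *)
From HB Require Import structures.
From mathcomp Require Import all_boot all_order all_fingroup all_algebra.
From mathcomp Require Import generic_quotient ring_quotient.
From mathcomp Require Import finmap.
From mathcomp.multinomials Require Import monalg.
From mathcomp Require Import mathcomp_extra boolp reals.
From mathcomp Require Import complex.

Set Implicit Arguments.
Unset Strict Implicit.
Unset Printing Implicit Defensive.

Import Order.TTheory GRing.Theory Num.Theory.
Local Open Scope quotient_scope.
Local Open Scope ring_scope.

(* [GRing.Algebra] requires 1 != 0, which cannot be granted a priori for an
   algebra given by generators and relations.  Here an F-algebra is a possibly
   trivial ring A with a central ring morphism F -> A, written c%:S. *)
HB.mixin Record hasScalars (F : fieldType) A of GRing.PzRing A := {
  scal : F -> A;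
  scal1 : scal 1 = 1;
  scalB : {morph scal : a b / a - b};
  scalM : {morph scal : a b / a * b};
  scalC : forall c x, scal c * x = x * scal c
}.
#[short(type="pzAlgType")]
HB.structure Definition PzAlgebra (F : fieldType) :=
  {A of hasScalars F A & GRing.PzRing A}.
Arguments scal {F s} c.
Notation "c %:S" := (scal c) (at level 2, left associativity, format "c %:S")
  : ring_scope.

HB.instance Definition _ (F : fieldType) (A : pzAlgType F) :=
  GRing.isZmodMorphism.Build F A scal scalB.
HB.instance Definition _ (F : fieldType) (A : pzAlgType F) :=
  GRing.isMonoidMorphism.Build F A scal (scal1, scalM).

HB.mixin Record isScalMorphism (F : fieldType) (A B : pzAlgType F) (f : A -> B) := {
  algh_scal : forall c : F, f c%:S = c%:S
}.
HB.structure Definition AlgHom (F : fieldType) (A B : pzAlgType F) :=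
  {f of @GRing.RMorphism A B f & isScalMorphism F A B f}.
Notation "{ 'alghom' A -> B }" := (@AlgHom.type _ A%type B%type)
  (at level 0, A at level 98, B at level 99) : type_scope.

(* The inverse of a two-sided unit (and 0 on the other elements). *)
Definition rinv (A : pzRingType) (x : A) : A :=
  if pselect (exists y, x * y = 1 /\ y * x = 1) is left h
  then projT1 (cid h) else 0.

(* Quotient of the free algebra [falg] on G by the two-sided ideal spanned by
   the differences x - y for which [r x y] holds. *)
Section Presentation.
Variables (F : fieldType) (G : choiceType).

Definition falg := {malg F[{fmonom G}]}.
HB.instance Definition _ := GRing.Lalgebra.on falg.

Definition fgen (g : G) : falg := << fmu g >>.

Lemma falg_scalar_mul (c : F) (x : falg) : (c *: 1) * x = x * (c *: 1).
Proof.
rewrite -scalerAl mul1r.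
have hU (k : {fmonom G}) a : c *: << a *g k >> = << a *g k >> * (c *: 1) :> falg.
  rewrite -[in RHS]mul_malgC mulr1 malgM_def fgmulUU mulm1.
  by apply/malgP => k'; rewrite mcoeffZ !mcoeffU mulrnAr mulrC.
rewrite [x]monalgE scaler_sumr mulr_suml; apply: eq_bigr => k _; exact: hU.
Qed.

Variable r : falg -> falg -> Prop.

Inductive ispan : falg -> Prop :=
| ispan0 : ispan 0
| ispanD x y : ispan x -> ispan y -> ispan (x + y)
| ispan_rel a b x y : r x y -> ispan (a * (x - y) * b).

Definition ideal : {pred falg} := [pred x | `[< ispan x >]].

Lemma ispanN x : ispan x -> ispan (- x).
Proof.
elim=> [|u v _ Hu _ Hv|a b u v ruv].
- by rewrite oppr0; exact: ispan0.
- by rewrite opprD; apply: ispanD.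
- by rewrite -mulNr -mulNr; exact: ispan_rel.
Qed.

Lemma ispanMl c x : ispan x -> ispan (c * x).
Proof.
elim=> [|u v _ Hu _ Hv|a b u v ruv].
- by rewrite mulr0; exact: ispan0.
- by rewrite mulrDr; apply: ispanD.
- by rewrite !mulrA; exact: ispan_rel.
Qed.

Lemma ispanMr c x : ispan x -> ispan (x * c).
Proof.
elim=> [|u v _ Hu _ Hv|a b u v ruv].
- by rewrite mul0r; exact: ispan0.
- by rewrite mulrDl; apply: ispanD.
- by rewrite -mulrA; exact: ispan_rel.
Qed.

Fact ideal_zmod_closed : zmod_closed ideal.
Proof.
split=> [|x y]; first by apply/asboolP; exact: ispan0.
by move=> /asboolP hx /asboolP hy; apply/asboolP/ispanD => //; exact: ispanN.
Qed.
HB.instance Definition _ := GRing.isZmodClosed.Build falg ideal ideal_zmod_closed.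

Definition palg : Type := @Quotient.quot falg ideal.
HB.instance Definition _ := GRing.Zmodule.on palg.

Definition ppi : falg -> palg := \pi_(@Quotient.quot falg ideal).

Lemma ppiE x y : ispan (x - y) <-> ppi x = ppi y.
Proof.
split=> [h|/eqP]; first by apply/eqP; rewrite /ppi eqmodE; apply/asboolP.
by rewrite /ppi eqmodE => /asboolP.
Qed.

Lemma ppi_zmod : zmod_morphism ppi.
Proof. by move=> x y; rewrite /ppi raddfB. Qed.
HB.instance Definition _ := GRing.isZmodMorphism.Build falg palg ppi ppi_zmod.

Definition plift (x : palg) : falg := repr (x : @Quotient.quot falg ideal).
Lemma pliftK x : ppi (plift x) = x. Proof. exact: reprK. Qed.

Lemma plift_span x : ispan (plift (ppi x) - x).
Proof. by apply/ppiE; rewrite pliftK. Qed.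

Definition pone : palg := ppi 1.
Definition pmul (x y : palg) : palg := ppi (plift x * plift y).

Lemma pmulE x y : pmul (ppi x) (ppi y) = ppi (x * y).
Proof.
apply/ppiE.
have -> : plift (ppi x) * plift (ppi y) - x * y
  = (plift (ppi x) - x) * plift (ppi y) + x * (plift (ppi y) - y).
  by rewrite mulrBl mulrBr addrA subrK.
by apply: ispanD; [apply: ispanMr|apply: ispanMl]; exact: plift_span.
Qed.

Fact pmulA : associative pmul.
Proof.
by move=> x y z; rewrite -(pliftK x) -(pliftK y) -(pliftK z) !pmulE mulrA.
Qed.
Fact pmul1r : left_id pone pmul.
Proof. by move=> x; rewrite -(pliftK x) pmulE mul1r. Qed.
Fact pmulr1 : right_id pone pmul.
Proof. by move=> x; rewrite -(pliftK x) pmulE mulr1. Qed.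
Fact pmulDl : left_distributive pmul +%R.
Proof.
move=> x y z; rewrite -(pliftK x) -(pliftK y) -(pliftK z).
by rewrite -raddfD !pmulE mulrDl raddfD.
Qed.
Fact pmulDr : right_distributive pmul +%R.
Proof.
move=> x y z; rewrite -(pliftK x) -(pliftK y) -(pliftK z).
by rewrite -raddfD !pmulE mulrDr raddfD.
Qed.
HB.instance Definition _ := GRing.Zmodule_isPzRing.Build palg
  pmulA pmul1r pmulr1 pmulDl pmulDr.

Fact ppi_monoid : monoid_morphism ppi.
Proof. by split=> // x y; rewrite -pmulE. Qed.
HB.instance Definition _ := GRing.isMonoidMorphism.Build falg palg ppi ppi_monoid.

Definition pscal (c : F) : palg := ppi (c *: 1).
Fact pscal1 : pscal 1 = 1. Proof. by rewrite /pscal scale1r rmorph1. Qed.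
Fact pscalB : {morph pscal : a b / a - b}.
Proof. by move=> a b; rewrite /pscal scalerBl rmorphB. Qed.
Fact pscalM : {morph pscal : a b / a * b}.
Proof. by move=> a b; rewrite /pscal -rmorphM -scalerAl mul1r scalerA. Qed.
Fact pscalC c x : pscal c * x = x * pscal c.
Proof. by rewrite -(pliftK x) /pscal -!rmorphM falg_scalar_mul. Qed.
HB.instance Definition _ :=
  hasScalars.Build F palg pscal1 pscalB pscalM pscalC.

Definition pgen (g : G) : palg := ppi (fgen g).

Lemma palg_rel x y : r x y -> ppi x = ppi y.
Proof.
by move=> rxy; apply/ppiE; rewrite -[x - y]mul1r -[_ * _]mulr1; exact: ispan_rel.
Qed.
End Presentation.

Section Eval.
Variables (F : fieldType) (G : choiceType) (B : pzAlgType F) (f : G -> B).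

Definition mev (m : {fmonom G}) : B := \prod_(g <- m) f g.
Definition fev (x : falg F G) : B := \sum_(k <- msupp x) (x@_k)%:S * mev k.

Lemma mevM m1 m2 : mev (mmul m1 m2) = mev m1 * mev m2.
Proof. by rewrite /mev fmM big_cat. Qed.

Lemma fevEw (d : {fset {fmonom G}}) x : (msupp x `<=` d)%fset ->
  fev x = \sum_(k <- d) (x@_k)%:S * mev k.
Proof.
move=> le; rewrite [LHS](big_fset_incl _ le) //= => k kd /mcoeff_outdom ->.
by rewrite raddf0 mul0r.
Qed.

Lemma fevU c m : fev << c *g m >> = c%:S * mev m.
Proof. by rewrite (fevEw msuppU_le) big_seq_fset1 mcoeffUU. Qed.

Fact fevB : zmod_morphism fev.
Proof.
move=> x y; set d := (msupp x `|` msupp y)%fset.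
have hx : (msupp x `<=` d)%fset by exact: fsubsetUl.
have hy : (msupp y `<=` d)%fset by exact: fsubsetUr.
rewrite (fevEw hx) (fevEw hy) (@fevEw d) ?msuppB_le//.
by rewrite -sumrB; apply: eq_bigr => k _; rewrite !raddfB /= mulrBl.
Qed.
HB.instance Definition _ := GRing.isZmodMorphism.Build (falg F G) B fev fevB.

Fact fev_monoid : monoid_morphism fev.
Proof.
split=> [|x y].
  by rewrite (_ : 1 = << 1 *g (mone : {fmonom G}) >>) // fevU rmorph1 mul1r /mev fm1 big_nil.
rewrite malgME raddf_sum mulr_suml; apply: eq_bigr => i _.
rewrite raddf_sum mulr_sumr; apply: eq_bigr => j _.
rewrite /= fevU rmorphM mevM -!mulrA; congr (_ * _).
by rewrite !mulrA; congr (_ * _); rewrite scalC.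
Qed.
HB.instance Definition _ := GRing.isMonoidMorphism.Build (falg F G) B fev fev_monoid.

Lemma fev_scal (c : F) : fev (c *: 1) = c%:S.
Proof.
rewrite (_ : c *: 1 = << c *g (mone : {fmonom G}) >>) ?fevU /mev ?fm1 ?big_nil ?mulr1 //.
by apply/malgP => k; rewrite mcoeffZ mcoeff1 mcoeffU mulr_natr eq_sym.
Qed.

Lemma fev_gen g : fev (fgen F g) = f g.
Proof. by rewrite /fgen fevU rmorph1 mul1r /mev fmU big_seq1. Qed.

Variable r : falg F G -> falg F G -> Prop.
Hypothesis fevr : forall x y, r x y -> fev x = fev y.

Definition pev of (forall x y, r x y -> fev x = fev y) :=
  fun x : palg r => fev (plift x).

Lemma fev_span x : ispan r x -> fev x = 0.
Proof.
elim=> [|u v _ hu _ hv|a b u v ruv]; first exact: rmorph0.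
  by rewrite rmorphD /= hu hv addr0.
by rewrite !rmorphM rmorphB /= (fevr ruv) subrr mulr0 mul0r.
Qed.

Lemma pev_pi x : pev fevr (ppi r x) = fev x.
Proof. by apply/eqP; rewrite -subr_eq0 /pev -rmorphB /= fev_span//; exact: plift_span. Qed.

Fact pevB : zmod_morphism (pev fevr).
Proof. by move=> x y; rewrite -(pliftK x) -(pliftK y) -rmorphB !pev_pi rmorphB. Qed.
HB.instance Definition _ := GRing.isZmodMorphism.Build (palg r) B (pev fevr) pevB.
Fact pev_monoid : monoid_morphism (pev fevr).
Proof.
split=> [|x y]; first by rewrite -(rmorph1 (ppi r)) pev_pi rmorph1.
by rewrite -(pliftK x) -(pliftK y) -rmorphM !pev_pi rmorphM.
Qed.
HB.instance Definition _ :=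
  GRing.isMonoidMorphism.Build (palg r) B (pev fevr) pev_monoid.
Fact pev_scal c : pev fevr c%:S = c%:S.
Proof. by rewrite {1}/scal /= pev_pi fev_scal. Qed.
HB.instance Definition _ :=
  isScalMorphism.Build F (palg r) B (pev fevr) pev_scal.

Lemma pev_gen g : pev fevr (pgen r g) = f g.
Proof. by rewrite pev_pi fev_gen. Qed.
End Eval.

Section Tensor.
Variables (F : fieldType) (J : choiceType) (A : J -> pzAlgType F).

Definition pure := forall j, A j.
HB.instance Definition _ := Choice.on pure.

Definition pset (x : pure) j (a : A j) : pure := @eqtype.dfwith J A x j a.

(* The free algebra on the pure tensors modulo [tens_mul] and [tens_one] is the
   algebra of the multiplicative monoid [pure]; the other relations are
   multilinearity. *)
Inductive tens_rel : falg F pure -> falg F pure -> Prop :=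
| tens_mul (x y : pure) :
    tens_rel (fgen F x * fgen F y) (fgen F ((fun j => x j * y j) : pure))
| tens_one : tens_rel (fgen F ((fun=> 1) : pure)) 1
| tens_add (x : pure) j (a b : A j) :
    tens_rel (fgen F (pset x (a + b))) (fgen F (pset x a) + fgen F (pset x b))
| tens_scal (x : pure) j (c : F) (a : A j) :
    tens_rel (fgen F (pset x (c%:S * a))) (c *: fgen F (pset x a)).

Definition tensor := palg tens_rel.
HB.instance Definition _ := PzAlgebra.on tensor.

Definition tens (x : pure) : tensor := pgen tens_rel x.

Lemma tensM x y : tens x * tens y = tens (fun j => x j * y j).
Proof. by rewrite /tens /pgen -rmorphM; apply: palg_rel; exact: tens_mul. Qed.
Lemma tens1 : tens (fun=> 1) = 1.
Proof.
by rewrite -(rmorph1 (@ppi _ _ tens_rel)); apply: palg_rel; exact: tens_one.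
Qed.
Lemma tensD x j (a b : A j) :
  tens (pset x (a + b)) = tens (pset x a) + tens (pset x b).
Proof. by rewrite /tens /pgen -rmorphD; apply: palg_rel; exact: tens_add. Qed.
Lemma tensZ x j (c : F) (a : A j) :
  tens (pset x (c%:S * a)) = c%:S * tens (pset x a).
Proof.
rewrite /tens /pgen (palg_rel (tens_scal _ _ _)).
by rewrite -[in LHS](mul1r (fgen _ _)) scalerAl rmorphM.
Qed.

(* 1 (x) ... (x) a (x) ... (x) 1 with a in the factor j *)
Definition tens_in j (a : A j) : tensor := tens (pset (fun=> 1) a).
End Tensor.

Section TensorMap.
Variables (F : fieldType) (J : choiceType) (A B : J -> pzAlgType F).
Variable phi : forall j, {alghom A j -> B j}.

Definition tmap_gen (x : pure A) : tensor B := tens (fun j => phi _ (x j) : B j).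

Lemma tmap_pset (x : pure A) j (a : A j) :
  (fun i => phi _ (pset x a i)) = pset (fun i => phi _ (x i) : B i) (phi _ a).
Proof.
apply/functional_extensionality_dep => i; rewrite /pset.
have [<-|ji] := eqVneq j i; first by rewrite !eqtype.dfwith_in.
by rewrite !eqtype.dfwith_out.
Qed.

Fact tmap_rel x y : tens_rel x y -> fev tmap_gen x = fev tmap_gen y.
Proof.
case=> {x y} [x y||x j a b|x j c a].
- rewrite rmorphM /= !fev_gen /tmap_gen tensM; congr tens.
  by apply/functional_extensionality_dep => j; rewrite rmorphM.
- rewrite fev_gen rmorph1 -tens1 /tmap_gen; congr tens.
  by apply/functional_extensionality_dep => j; rewrite rmorph1.
- by rewrite rmorphD /= !fev_gen /tmap_gen !tmap_pset rmorphD tensD.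
- rewrite -[X in _ *: X]mul1r scalerAl rmorphM /= fev_scal !fev_gen.
  by rewrite /tmap_gen !tmap_pset rmorphM /= algh_scal tensZ.
Qed.

Definition tmap : {alghom tensor A -> tensor B} := pev tmap_rel.

Lemma tmap_tens (x : pure A) : tmap (tens x) = tens (fun j => phi _ (x j) : B j).
Proof. exact: pev_gen. Qed.
End TensorMap.

Section DirectSum.
Variables (F : fieldType) (I : finType) (A : I -> pzAlgType F).

Definition dsum := forall i, A i.
HB.instance Definition _ := Choice.on dsum.

Definition dsum0 : dsum := fun=> 0.
Definition dsumN (x : dsum) : dsum := fun i => - x i.
Definition dsumD (x y : dsum) : dsum := fun i => x i + y i.
Definition dsum1 : dsum := fun=> 1.
Definition dsumM (x y : dsum) : dsum := fun i => x i * y i.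
Definition dsumS (c : F) : dsum := fun=> c%:S.

Let dext (x y : dsum) : (forall i, x i = y i) -> x = y.
Proof. exact: functional_extensionality_dep. Qed.

Fact dsumDA : associative dsumD.
Proof. by move=> x y z; apply: dext => i; exact: addrA. Qed.
Fact dsumDC : commutative dsumD.
Proof. by move=> x y; apply: dext => i; exact: addrC. Qed.
Fact dsum0D : left_id dsum0 dsumD.
Proof. by move=> x; apply: dext => i; exact: add0r. Qed.
Fact dsumND : left_inverse dsum0 dsumN dsumD.
Proof. by move=> x; apply: dext => i; exact: addNr. Qed.
Fact dsumMA : associative dsumM.
Proof. by move=> x y z; apply: dext => i; exact: mulrA. Qed.
Fact dsum1M : left_id dsum1 dsumM.
Proof. by move=> x; apply: dext => i; exact: mul1r. Qed.
Fact dsumM1 : right_id dsum1 dsumM.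
Proof. by move=> x; apply: dext => i; exact: mulr1. Qed.
Fact dsumMDl : left_distributive dsumM dsumD.
Proof. by move=> x y z; apply: dext => i; exact: mulrDl. Qed.
Fact dsumMDr : right_distributive dsumM dsumD.
Proof. by move=> x y z; apply: dext => i; exact: mulrDr. Qed.
HB.instance Definition _ := GRing.isZmodule.Build dsum
  dsumDA dsumDC dsum0D dsumND.
HB.instance Definition _ := GRing.Zmodule_isPzRing.Build dsum
  dsumMA dsum1M dsumM1 dsumMDl dsumMDr.

Fact dsumS1 : dsumS 1 = 1. Proof. by apply: dext => i; exact: scal1. Qed.
Fact dsumSB : {morph dsumS : a b / a - b}.
Proof. by move=> a b; apply: dext => i; exact: scalB. Qed.
Fact dsumSM : {morph dsumS : a b / a * b}.
Proof. by move=> a b; apply: dext => i; exact: scalM. Qed.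
Fact dsumSC c x : dsumS c * x = x * dsumS c.
Proof. by apply: dext => i; exact: scalC. Qed.
HB.instance Definition _ := hasScalars.Build F dsum dsumS1 dsumSB dsumSM dsumSC.

Definition dsum_in i (a : A i) : dsum := @eqtype.dfwith I A (fun=> 0) i a.
End DirectSum.

Section MatrixAlg.
Variables (F : fieldType) (m : nat) (A : pzAlgType F).

Definition mxscal (c : F) : 'M[A]_m := c%:S%:M.
Fact mxscal1 : mxscal 1 = 1. Proof. by rewrite /mxscal rmorph1. Qed.
Fact mxscalB : {morph mxscal : a b / a - b}.
Proof. by move=> a b; rewrite /mxscal !rmorphB. Qed.
Fact mxscalM : {morph mxscal : a b / a * b}.
Proof. by move=> a b; rewrite /mxscal !rmorphM. Qed.
Fact mxscalC c x : mxscal c * x = x * mxscal c.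
Proof.
rewrite -mulmxE; apply/matrixP => i j; rewrite /mxscal mul_scalar_mx !mxE.
rewrite (bigD1 j)//= big1 ?addr0 => [|k kj]; rewrite !mxE ?eqxx ?mulr1n ?scalC//.
by rewrite (negbTE kj) mulr0.
Qed.
HB.instance Definition _ :=
  hasScalars.Build F 'M[A]_m mxscal1 mxscalB mxscalM mxscalC.
End MatrixAlg.

(* Positions are numbered from 0: [a : 'I_m.-1] stands for the simple
   transposition of [lpos a] and [rpos a], i.e. of the positions a and a + 1. *)
Section Words.
Variable m : nat.

Definition lpos (a : 'I_m.-1) : 'I_m := widen_ord (leq_pred m) a.
Fact rpos_subproof (a : 'I_m.-1) : (a.+1 < m)%N.
Proof. by rewrite -ltn_predRL. Qed.
Definition rpos (a : 'I_m.-1) : 'I_m := Ordinal (rpos_subproof a).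
Definition sadj (a : 'I_m.-1) : 'S_m := tperm (lpos a) (rpos a).

(* The product s_{a_1} ... s_{a_r} as a composition of functions; the product
   of [perm] composes in the opposite order. *)
Definition wperm (l : seq 'I_m.-1) : 'S_m :=
  foldr (fun a w => w * sadj a)%g 1%g l.

Lemma wperm_cat l1 l2 : wperm (l1 ++ l2) = (wperm l2 * wperm l1)%g.
Proof. by elim: l1 => [|a l IH] /=; rewrite ?mulg1// IH mulgA. Qed.

Lemma wperm_tperm (k : nat) (i j : 'I_m) : j = (i + k)%N :> nat ->
  exists l, wperm l = tperm i j.
Proof.
elim: k i j => [|k IH] i j jE.
  exists [::]; have -> : j = i by apply: val_inj; rewrite /= jE addn0.
  by rewrite tperm1.
have im : (i < m.-1)%N.
  rewrite ltn_predRL; apply: leq_ltn_trans (ltn_ord j).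
  by rewrite jE addnS ltnS leq_addr.
pose a := Ordinal im; have li : lpos a = i by exact: val_inj.
have [k0|k0] := eqVneq k 0%N.
  exists [:: a]; rewrite /= mul1g /sadj li; congr tperm.
  by apply: val_inj; rewrite /= jE k0 addn1.
have [|l hl] := IH (rpos a) j; first by rewrite jE /= addnS addSn.
exists ([:: a] ++ l ++ [:: a]); rewrite !wperm_cat hl /= !mul1g.
have -> : (sadj a * tperm (rpos a) j * sadj a = tperm (rpos a) j ^ sadj a)%g.
  by rewrite conjgE tpermV mulgA.
rewrite tpermJ /sadj tpermR li tpermD// -val_eqE /= jE.
  by rewrite -{1}[nat_of_ord i]addn0 eqn_add2l.
by rewrite -addn1 eqn_add2l eq_sym eqSS.
Qed.

Lemma wperm_surj (w : 'S_m) : exists l, wperm l = w.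
Proof.
have [ts -> _] := prod_tpermP w; elim: ts => [|[i j] ts [l hl]].
  by exists [::]; rewrite big_nil.
suff [l' hl'] : exists l', wperm l' = tperm i j.
  by exists (l ++ l'); rewrite big_cons wperm_cat hl hl'.
have [ij|ji] := leqP i j.
  by apply: (@wperm_tperm (j - i)); rewrite subnKC.
by rewrite tpermC; apply: (@wperm_tperm (i - j)); rewrite subnKC// ltnW.
Qed.

Fact slen_subproof (w : 'S_m) :
  exists k, `[< exists l, size l = k /\ wperm l = w >].
Proof. by have [l hl] := wperm_surj w; exists (size l); apply/asboolP; exists l. Qed.
Definition slen (w : 'S_m) : nat := ex_minn (slen_subproof w).

Definition reduced_word (w : 'S_m) (l : seq 'I_m.-1) : Prop :=
  wperm l = w /\ size l = slen w.

Definition pact (T : Type) (s : 'S_m) (x : {ffun 'I_m -> T}) : {ffun 'I_m -> T} :=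
  [ffun i => x (s^-1 i)%g].
End Words.

Inductive ygen (m : nat) :=
  | GenG of 'I_m.-1 | GenT of 'I_m | GenX1 of (0 < m)%N.
HB.instance Definition _ m := gen_eqMixin (ygen m).
HB.instance Definition _ m := gen_choiceMixin (ygen m).

Section Yokonuma.
Variables (F : fieldType) (e : nat) (q : F) (L : 'Z_e -> nat) (d m : nat).

Let g (a : 'I_m.-1) : falg F (ygen m) := fgen F (GenG a).
Let t (b : 'I_m) : falg F (ygen m) := fgen F (GenT b).
Let X1 (h : (0 < m)%N) : falg F (ygen m) := fgen F (@GenX1 m h).

(* j ranges over {1, ..., d}; as t_{a+1}^d = 1, t_{a+1}^(d - j) is t_{a+1}^-j. *)
Definition yidem (a : 'I_m.-1) : falg F (ygen m) :=
  d%:R^-1 *: \sum_(1 <= j < d.+1) t (lpos a) ^+ j * t (rpos a) ^+ (d - j).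

Inductive yrel : falg F (ygen m) -> falg F (ygen m) -> Prop :=
| yrel_torder b : yrel (t b ^+ d) 1
| yrel_tt a b : yrel (t a * t b) (t b * t a)
| yrel_tg a b : yrel (t b * g a) (g a * t (sadj a b))
| yrel_gg a : yrel (g a ^+ 2) (q *: 1 + (q - 1) *: (g a * yidem a))
| yrel_far (a b : 'I_m.-1) : (a.+1 < b)%N || (b.+1 < a)%N ->
    yrel (g a * g b) (g b * g a)
| yrel_braid (a b : 'I_m.-1) : b = a.+1 :> nat ->
    yrel (g b * g a * g b) (g a * g b * g a)
| yrel_XgXg h (a : 'I_m.-1) : a = 0%N :> nat ->
    yrel (X1 h * g a * X1 h * g a) (g a * X1 h * g a * X1 h)
| yrel_Xg h (a : 'I_m.-1) : (0 < a)%N -> yrel (X1 h * g a) (g a * X1 h)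
| yrel_Xt h b : yrel (X1 h * t b) (t b * X1 h)
| yrel_cyc h : yrel (\prod_(i : 'Z_e) (X1 h - q ^+ i *: 1) ^+ L i) 0.

Definition Yok : pzAlgType F := palg yrel.

Definition Yg (a : 'I_m.-1) : Yok := pgen yrel (GenG a).
Definition Yt (b : 'I_m) : Yok := pgen yrel (GenT b).

(* The generators indexed by all natural numbers, 0 for an index out of range. *)
Definition Yg_ (a : nat) : Yok := if insub a is Some a' then Yg a' else 0.
Definition YX1 : Yok :=
  match @idP (0 < m)%N with
  | ReflectT h => pgen yrel (@GenX1 m h)
  | ReflectF _ => 0
  end.
Fixpoint YX (a : nat) : Yok :=
  if a is a'.+1 then q^-1%:S * (Yg_ a' * YX a' * Yg_ a') else YX1.
End Yokonuma.

Definition Hecke (F : fieldType) (e : nat) (q : F) (L : 'Z_e -> nat) (m : nat) :=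
  Yok q L 1 m.

Inductive qgen (V : finType) (m : nat) :=
  | GenE of {ffun 'I_m -> V} | GenY of 'I_m | GenPsi of 'I_m.-1.
HB.instance Definition _ V m := gen_eqMixin (qgen V m).
HB.instance Definition _ V m := gen_choiceMixin (qgen V m).

Section QuiverHecke.
Variables (F : fieldType) (V : finType) (edge : rel V) (L : V -> nat) (m : nat).

Definition arrow (v w : V) := edge v w && ~~ edge w v.
Definition biarrow (v w : V) := edge v w && edge w v.
Definition unlinked (v w : V) := [&& v != w, ~~ edge v w & ~~ edge w v].

Let E (k : {ffun 'I_m -> V}) : falg F (qgen V m) := fgen F (GenE k).
Let y (a : 'I_m) : falg F (qgen V m) := fgen F (@GenY V m a).
Let psi (a : 'I_m.-1) : falg F (qgen V m) := fgen F (@GenPsi V m a).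

Inductive qrel : falg F (qgen V m) -> falg F (qgen V m) -> Prop :=
| qrel_sum : qrel (\sum_k E k) 1
| qrel_EE k k' : qrel (E k * E k') (if k == k' then E k else 0)
| qrel_yE a (k : {ffun 'I_m -> V}) : qrel (y a * E k) (E k * y a)
| qrel_psiE a (k : {ffun 'I_m -> V}) : qrel (psi a * E k) (E (pact (sadj a) k) * psi a)
| qrel_yy a b : qrel (y a * y b) (y b * y a)
| qrel_psiy a b : b != lpos a -> b != rpos a -> qrel (psi a * y b) (y b * psi a)
| qrel_far (a b : 'I_m.-1) : (a.+1 < b)%N || (b.+1 < a)%N ->
    qrel (psi a * psi b) (psi b * psi a)
| qrel_psiyr a (k : {ffun 'I_m -> V}) :
    qrel (psi a * y (rpos a) * E k)
         ((y (lpos a) * psi a + (k (lpos a) == k (rpos a))%:R) * E k)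
| qrel_ypsi a (k : {ffun 'I_m -> V}) :
    qrel (y (rpos a) * psi a * E k)
         ((psi a * y (lpos a) + (k (lpos a) == k (rpos a))%:R) * E k)
| qrel_sq_eq a (k : {ffun 'I_m -> V}) : k (lpos a) = k (rpos a) -> qrel (psi a ^+ 2 * E k) 0
| qrel_sq_unlinked a (k : {ffun 'I_m -> V}) : unlinked (k (lpos a)) (k (rpos a)) ->
    qrel (psi a ^+ 2 * E k) (E k)
| qrel_sq_to a (k : {ffun 'I_m -> V}) : arrow (k (lpos a)) (k (rpos a)) ->
    qrel (psi a ^+ 2 * E k) ((y (rpos a) - y (lpos a)) * E k)
| qrel_sq_from a (k : {ffun 'I_m -> V}) : arrow (k (rpos a)) (k (lpos a)) ->
    qrel (psi a ^+ 2 * E k) ((y (lpos a) - y (rpos a)) * E k)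
| qrel_sq_both a (k : {ffun 'I_m -> V}) : biarrow (k (lpos a)) (k (rpos a)) ->
    qrel (psi a ^+ 2 * E k)
         ((y (rpos a) - y (lpos a)) * (y (lpos a) - y (rpos a)) * E k)
| qrel_braid (a b : 'I_m.-1) (k : {ffun 'I_m -> V}) : b = a.+1 :> nat ->
    qrel (psi b * psi a * psi b * E k)
         ((psi a * psi b * psi a +
           (if k (rpos b) != k (lpos a) then 0
            else if arrow (k (lpos a)) (k (rpos a)) then -1
            else if arrow (k (rpos a)) (k (lpos a)) then 1
            else if biarrow (k (lpos a)) (k (rpos a))
                 then y (rpos a) *+ 2 - y (lpos a) - y (rpos b)
            else 0)) * E k)
| qrel_cyc (a : 'I_m) (k : {ffun 'I_m -> V}) : a = 0%N :> nat -> qrel (y a ^+ L (k a) * E k) 0.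

Definition QHecke : pzAlgType F := palg qrel.

Definition Qe (k : {ffun 'I_m -> V}) : QHecke := pgen qrel (GenE k).
Definition Qy (a : 'I_m) : QHecke := pgen qrel (@GenY V m a).
Definition Qpsi (a : 'I_m.-1) : QHecke := pgen qrel (@GenPsi V m a).
Definition Qpsiw (l : seq 'I_m.-1) : QHecke := \prod_(a <- l) Qpsi a.
End QuiverHecke.

(* J = {1, ..., d} is represented by 'I_d, with j : 'I_d standing for j + 1. *)
Definition edge_e (e : nat) : rel 'Z_e := fun i i' => i' == i + 1.
Definition edge_K (e d : nat) : rel ('Z_e * 'I_d) :=
  fun k k' => (k'.1 == k.1 + 1) && (k'.2 == k.2).

Section Sides.
Variables (F : fieldType) (e : nat) (L : 'Z_e -> nat).
Definition HI (m : nat) : pzAlgType F := QHecke F (@edge_e e) L m.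
Definition HK (d m : nat) : pzAlgType F :=
  QHecke F (@edge_K e d) (fun k => L k.1) m.
End Sides.

Section PowerSeries.
Variables (F : fieldType) (e : nat) (q sq : F) (A : pzAlgType F).

(* The power series at arguments i = i_a, i' = i_{a+1}, y = y_a, y' = y_{a+1}.
   Their denominators are power series in the nilpotent y, y' with nonzero
   constant terms; hence they are units, inverted by [rinv]. *)
Definition yI (i : 'Z_e) (y : A) : A := (q ^+ i)%:S * (1 - y).

Definition Qser (i i' : 'Z_e) (y y' : A) : A :=
  let u := yI i y in let u' := yI i' y' in
  if i == i' then 1 - q%:S + q%:S * y' - y
  else if arrow (@edge_e e) i i' then (u - q%:S * u') * rinv ((u - u') ^+ 2)
  else if arrow (@edge_e e) i' i then (q ^+ i)%:S
  else if biarrow (@edge_e e) i i' then (q ^+ i)%:S * rinv (u - u')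
  else (u - q%:S * u') * rinv (u - u').

Definition Pser (i i' : 'Z_e) (y y' : A) : A :=
  if i == i' then 1
  else (1 - q)%:S * rinv (1 - yI i y * rinv (yI i' y')).

Definition QserK (d : nat) (k k' : 'Z_e * 'I_d) (y y' : A) : A :=
  if k.2 == k'.2 then Qser k.1 k'.1 y y' else sq%:S.
Definition PserK (d : nat) (k k' : 'Z_e * 'I_d) (y y' : A) : A :=
  if k.2 == k'.2 then Pser k.1 k'.1 y y' else 0.
End PowerSeries.

Section BK.
Variables (F : fieldType) (e : nat) (q sq xi : F) (L : 'Z_e -> nat).

Section OneComponent.
Variable m : nat.
Let e_ (k : {ffun 'I_m -> 'Z_e}) : HI F L m := Qe F (@edge_e e) L k.
Let y (a : 'I_m) : HI F L m := Qy F (@edge_e e) L a.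
Let psi (a : 'I_m.-1) : HI F L m := Qpsi F (@edge_e e) L a.
Let Q (a : 'I_m.-1) (k : {ffun 'I_m -> 'Z_e}) : HI F L m :=
  Qser q (k (lpos a)) (k (rpos a)) (y (lpos a)) (y (rpos a)).
Let P (a : 'I_m.-1) (k : {ffun 'I_m -> 'Z_e}) : HI F L m :=
  Pser q (k (lpos a)) (k (rpos a)) (y (lpos a)) (y (rpos a)).

Definition is_BK (f : {alghom Hecke q L m -> HI F L m}) : Prop :=
  (forall a, f (Yg q L 1 a) =
     \sum_(k : {ffun 'I_m -> 'Z_e}) (psi a * Q a k - P a k) * e_ k) /\
  (forall a : 'I_m, f (YX q L 1 m a) =
     \sum_(k : {ffun 'I_m -> 'Z_e}) (q ^+ k a)%:S * (1 - y a) * e_ k).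
End OneComponent.

Section BKtilde.
Variables (d n : nat).
Let e_ (k : {ffun 'I_n -> 'Z_e * 'I_d}) : HK F L d n :=
  Qe F (@edge_K e d) (fun k => L k.1) k.
Let y (a : 'I_n) : HK F L d n := Qy F (@edge_K e d) (fun k => L k.1) a.
Let psi (a : 'I_n.-1) : HK F L d n :=
  Qpsi F (@edge_K e d) (fun k => L k.1) a.
Let Q (a : 'I_n.-1) (k : {ffun 'I_n -> 'Z_e * 'I_d}) : HK F L d n :=
  QserK q sq (k (lpos a)) (k (rpos a)) (y (lpos a)) (y (rpos a)).
Let P (a : 'I_n.-1) (k : {ffun 'I_n -> 'Z_e * 'I_d}) : HK F L d n :=
  PserK q (k (lpos a)) (k (rpos a)) (y (lpos a)) (y (rpos a)).

Definition is_BKtilde (f : {alghom Yok q L d n -> HK F L d n}) : Prop :=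
  [/\ forall a, f (Yg q L d a) =
        \sum_(k : {ffun 'I_n -> 'Z_e * 'I_d}) (psi a * Q a k - P a k) * e_ k,
      forall a, f (Yt q L d a) =
        \sum_(k : {ffun 'I_n -> 'Z_e * 'I_d}) (xi ^+ (k a).2.+1)%:S * e_ k
    & forall a : 'I_n, f (YX q L d n a) =
        \sum_(k : {ffun 'I_n -> 'Z_e * 'I_d}) (q ^+ (k a).1)%:S * (1 - y a) * e_ k].
End BKtilde.
End BK.

Definition dcomp (d n : nat) :=
  {l : {ffun 'I_d -> 'I_n.+1} | (\sum_j l j == n :> nat)%N}.
HB.instance Definition _ d n := Finite.on (dcomp d n).
Definition part d n (l : dcomp d n) (j : 'I_d) : nat := val l j.

Section Compositions.
Variables (d n : nat) (l : dcomp d n).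

Definition offset (j : 'I_d) : nat := (\sum_(i < d | (i < j)%N) part l i)%N.

(* J^lambda; the rows and columns of the matrices are indexed by its
   enumeration. *)
Definition Jset : {set {ffun 'I_n -> 'I_d}} :=
  [set t : {ffun 'I_n -> 'I_d} |
    [forall j, #|[set a | t a == j]| == part l j]].

Definition tlam_seq : seq 'I_d :=
  flatten [seq nseq (part l j) j | j <- enum 'I_d].
Fact tlam_subproof : size tlam_seq == n.
Proof.
rewrite size_flatten /shape -map_comp sumnE big_map big_enum /=.
by rewrite (eq_bigr (part l)) => [|j _]; rewrite ?size_nseq//; exact: (valP l).
Qed.
Definition tlam : {ffun 'I_n -> 'I_d} := [ffun a => tnth (Tuple tlam_subproof) a].

Definition pi_ (t : {ffun 'I_n -> 'I_d}) : 'S_n :=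
  [arg min_(w < 1%g : 'S_n | pact w t == tlam) slen w].

(* v E_{t', t} *)
Definition Emx (F : fieldType) (A : pzAlgType F) (v : A)
    (t' t : {ffun 'I_n -> 'I_d}) : 'M[A]_#|Jset| :=
  \matrix_(r, c) if (enum_val r == t') && (enum_val c == t) then v else 0.
End Compositions.

Section Maps.
Variables (F : fieldType) (e : nat) (q sq xi : F) (L : 'Z_e -> nat) (d n : nat).

Definition Hecke_l (l : dcomp d n) : pzAlgType F :=
  tensor (fun j : 'I_d => Hecke q L (part l j)).
Definition HI_l (l : dcomp d n) : pzAlgType F :=
  tensor (fun j : 'I_d => HI F L (part l j)).

Definition MatHecke : pzAlgType F :=
  dsum (fun l : dcomp d n => 'M[Hecke_l l]_#|Jset l|).
Definition MatHI : pzAlgType F :=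
  dsum (fun l : dcomp d n => 'M[HI_l l]_#|Jset l|).

(* The generators of the tensor product with shifted indices: the position b
   lies in the block of the factor [tlam l b]. *)
Definition gl (l : dcomp d n) (b : 'I_n) : Hecke_l l :=
  tens_in (A := fun j => Hecke q L (part l j)) (j := tlam l b)
    (Yg_ q L 1 (part l (tlam l b)) (b - offset l (tlam l b))).
Definition Xl (l : dcomp d n) (b : 'I_n) : Hecke_l l :=
  tens_in (A := fun j => Hecke q L (part l j)) (j := tlam l b)
    (YX q L 1 (part l (tlam l b)) (b - offset l (tlam l b))).

Definition is_JPA (f : {alghom Yok q L d n -> MatHecke}) : Prop :=
  [/\ forall a l, f (Yt q L d a) l =
        \sum_(t in Jset l) Emx l (xi ^+ (t a).+1)%:S t t,
      forall (a : 'I_n) l, f (YX q L d n a) l =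
        \sum_(t in Jset l) Emx l (Xl l (pi_ l t a)) t t
    & forall (a : 'I_n.-1) l, f (Yg q L d a) l =
        \sum_(t in Jset l | t (lpos a) == t (rpos a))
           Emx l (gl l (pi_ l t (lpos a))) t t
        + \sum_(t in Jset l | t (lpos a) != t (rpos a))
           Emx l sq%:S t (pact (sadj a) t)].

Definition BKmap (bk : forall m, {alghom Hecke q L m -> HI F L m})
    (M : MatHecke) : MatHI :=
  fun l => map_mx (tmap (fun j => bk (part l j))) (M l).

Definition e_tlam (l : dcomp d n) : HK F L d n :=
  \sum_(k : {ffun 'I_n -> 'Z_e * 'I_d} | [ffun a => (k a).2] == tlam l)
    Qe F (@edge_K e d) (fun k => L k.1) k.

(* How v in HI_l l is viewed in e(tlam) HK e(tlam): f is a non-unital morphism,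
   f 1 = e_tlam l being the sum of the equations on the idempotents. *)
Definition is_corner_embedding (l : dcomp d n) (f : HI_l l -> HK F L d n) : Prop :=
  [/\ {morph f : u v / u + v}, {morph f : u v / u * v}
    & forall (c : F) v, f (c%:S * v) = c%:S * f v] /\
  [/\ forall (j : 'I_d) (b : 'I_(part l j)) (a : 'I_n),
        a = (offset l j + b)%N :> nat ->
        f (tens_in (A := fun j => HI F L (part l j)) (Qy F (@edge_e e) L b))
        = Qy F (@edge_K e d) (fun k => L k.1) a * e_tlam l,
      forall (j : 'I_d) (b : 'I_(part l j).-1) (a : 'I_n.-1),
        a = (offset l j + b)%N :> nat ->
        f (tens_in (A := fun j => HI F L (part l j)) (Qpsi F (@edge_e e) L b))
        = Qpsi F (@edge_K e d) (fun k => L k.1) a * e_tlam l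
    & forall (k_ : forall j : 'I_d, {ffun 'I_(part l j) -> 'Z_e})
             (k : {ffun 'I_n -> 'Z_e * 'I_d}),
        (forall j (b : 'I_(part l j)) (a : 'I_n),
           a = (offset l j + b)%N :> nat -> k a = (k_ j b, j)) ->
        f (tens (fun j => Qe F (@edge_e e) L (k_ j) : HI F L (part l j)))
        = Qe F (@edge_K e d) (fun k => L k.1) k].

Definition is_Phi (red : 'S_n -> seq 'I_n.-1)
    (iota : forall l, HI_l l -> HK F L d n)
    (f : {alghom MatHI -> HK F L d n}) : Prop :=
  forall l (v : HI_l l) (t' t : {ffun 'I_n -> 'I_d}),
    t' \in Jset l -> t \in Jset l ->
    f (dsum_in (A := fun l => 'M[HI_l l]_#|Jset l|) (Emx l v t' t)) =
      Qpsiw F (@edge_K e d) (fun k => L k.1) (red (pi_ l t')^-1%g) * iota l v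
      * Qpsiw F (@edge_K e d) (fun k => L k.1) (red (pi_ l t)).
End Maps.

(* Main.v *)
(** Everything is compared on the generators of the Yokonuma-Hecke algebra and after
    multiplication on the right by each idempotent e(k).  Let t be the colour word of
    k (its J-components).  A reduced word of pi_t, or the reverse of one of pi_t^-1,
    has length the number of inversions of t, so each of its letters exchanges a
    strict descent of colours; on such colours psi_a squares to 1, satisfies the braid
    relation without error term, and permutes the y's.  By Newman's lemma all words
    sorting t by descents give the same product psi_{pi_t} e(t), whose inverse is
    psi_{pi_t^-1} e(t^lambda).  If t_a = t_{a+1}, a sorting word can be chosen that
    carries the two equal letters together, whence
    psi_b psi_{pi_t} e(t) = psi_{pi_t} psi_a e(t) with b = pi_t(a).  The power series
    Q and P are transported along intertwiners and corners because their denominators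
    are units, the y's being nilpotent. *)
Require Import Defs.
From mathcomp Require Import all_boot all_order all_fingroup all_algebra.
From mathcomp Require Import finmap.
From mathcomp.multinomials Require Import monalg.
From mathcomp Require Import mathcomp_extra boolp zify.
From mathcomp Require Import reals complex.

Set Implicit Arguments.
Unset Strict Implicit.
Unset Printing Implicit Defensive.

Import GRing.Theory Num.Theory.
Local Open Scope ring_scope.

(** * Units and power series *)

(** The images of the generators under JPA are monomial matrices: column t has at most one nonzero
    entry, in row t or in row s_a t. Multiplying by e(k) on the right therefore isolates a single
    entry, and the theorem splits into one identity for each generator and each k. A diagonal entry
    is conjugated by psi_{pi_t}; an off-diagonal entry is the scalar sqrt q, and what has to be
    shown there is psi_{pi_{s_a t}^-1} psi_{pi_t} e(t) = psi_a e(t). The obstacle is the series.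
    Their denominators are hidden behind [rinv], which is 0 outside the units, so no series can be
    carried through a map before its denominators are known to be invertible on both sides. Hence
    the nilpotency of the y's is derived from the defining relations, in H(Gamma) and in each factor
    H(Gamma_e). Moreover the corner embedding sends 1 to an idempotent, so that inverses in a factor
    correspond to inverses in a corner rather than in the whole algebra. *)

Section Invertible.
Variable A : pzRingType.
Implicit Types x y z : A.

Definition invertible x := exists y, x * y = 1 /\ y * x = 1.

Lemma rinvP x : invertible x -> x * rinv x = 1 /\ rinv x * x = 1.
Proof. by rewrite /rinv => h; case: pselect => // h'; case: cid. Qed.

Lemma invertibleM x y : invertible x -> invertible y -> invertible (x * y).
Proof.
move=> [x' [xx' x'x]] [y' [yy' y'y]]; exists (y' * x'); split.
  by rewrite mulrA -(mulrA x) yy' mulr1.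
by rewrite mulrA -(mulrA y') x'x mulr1.
Qed.

Lemma invertible_rinv x : invertible x -> invertible (rinv x).
Proof. by move=> /rinvP [h1 h2]; exists x. Qed.

Lemma comm_rinv x y : invertible x -> GRing.comm x y -> GRing.comm (rinv x) y.
Proof.
move=> /rinvP [h1 h2] xy; rewrite /GRing.comm.
by rewrite -[in LHS](mulr1 y) -h1 !mulrA -(mulrA _ y x) -xy mulrA h2 mul1r.
Qed.

Definition nilpotent x := exists N, x ^+ N = 0.

Lemma nilpotentM x y : GRing.comm x y -> nilpotent x -> nilpotent (x * y).
Proof. by move=> xy [N h]; exists N; rewrite exprMn_comm// h mul0r. Qed.

Lemma nilpotentN x : nilpotent x -> nilpotent (- x).
Proof. by move=> [N h]; exists N; rewrite exprNn h mulr0. Qed.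

Lemma nilpotentD x y : GRing.comm x y -> nilpotent x -> nilpotent y ->
  nilpotent (x + y).
Proof.
move=> xy [N hN] [M hM]; exists (N + M)%N; rewrite exprDn_comm// big1// => i _.
have [Mi|iM] := leqP M i.
  by rewrite -(subnKC Mi) exprD hM mul0r mulr0 mul0rn.
have NI : (N <= N + M - i)%N by rewrite -addnBA ?leq_addr// ltnW.
by rewrite -(subnKC NI) exprD hN !mul0r mul0rn.
Qed.

(** The inverse is the geometric series, which nilpotency makes finite. *)
Lemma invertible1B x : nilpotent x -> invertible (1 - x).
Proof.
move=> [N hN]; exists (\sum_(i < N) x ^+ i).
have h : (1 - x) * (\sum_(i < N) x ^+ i) = 1.
  have := subrX1 x N; rewrite hN sub0r => h.
  by rewrite -[1 - x]opprB mulNr -h opprK.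
split=> //; rewrite -[RHS]h; apply/commr_sym/commr_sum => i _.
exact/commrX/commr_sym/commrB/commr_refl/commr1.
Qed.
End Invertible.

Section InvertibleAlg.
Variables (F : fieldType) (A : pzAlgType F).

Lemma comm_scal (c : F) (x : A) : GRing.comm c%:S x.
Proof. exact: scalC. Qed.

Lemma invertible_scal (c : F) : c != 0 -> invertible (c%:S : A).
Proof.
by move=> c0; exists (c^-1)%:S; rewrite -!rmorphM /= mulfV// mulVf// rmorph1.
Qed.

Lemma invertible_scalD (c : F) (x : A) : c != 0 -> nilpotent x ->
  invertible (c%:S + x).
Proof.
move=> c0 nx.
have -> : c%:S + x = c%:S * (1 - (- (c^-1)%:S * x)).
  by rewrite mulrBr mulr1 mulNr mulrN opprK mulrA -rmorphM mulfV// rmorph1 mul1r.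
apply: invertibleM; first exact: invertible_scal.
apply: invertible1B; rewrite mulNr; apply: nilpotentN; rewrite scalC.
by apply: nilpotentM => //; exact/commr_sym/comm_scal.
Qed.
End InvertibleAlg.

Section SeriesUnits.
Variables (F : fieldType) (e : nat) (q : F) (A : pzAlgType F).
Hypotheses (e_gt1 : (1 < e)%N) (q_prim : e.-primitive_root q).
Implicit Types (i : 'Z_e) (y : A).

Let q_neq0 : q != 0.
Proof.
apply: contraTneq (oner_neq0 F) => q0; rewrite -(prim_expr_order q_prim) q0.
by rewrite expr0n gtn_eqF ?eqxx// ltnW.
Qed.

Lemma invertible_yI i y : nilpotent y -> invertible (yI q i y).
Proof.
move=> ny; apply: invertibleM; last exact: invertible1B.
by apply: invertible_scal; rewrite expf_neq0.
Qed.

(** The constant term is q^i - q^i', nonzero because i and i' have distinct representatives below e;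
    [Zp_cast] needs e > 1 to identify the size of ['Z_e] with e. *)
Lemma invertible_yIB i i' y y' : GRing.comm y y' -> nilpotent y -> nilpotent y' ->
  i != i' -> invertible (yI q i y - yI q i' y').
Proof.
move=> yy' ny ny' ii'.
have -> : yI q i y - yI q i' y' =
    (q ^+ i - q ^+ i')%:S + ((q ^+ i')%:S * y' - (q ^+ i)%:S * y).
  rewrite /yI !mulrBr !mulr1 rmorphB opprB -!addrA; congr (_ + _).
  by rewrite addrCA [RHS]addrCA [- _ - _]addrC.
apply: invertible_scalD.
  rewrite subr_eq0 (eq_prim_root_expr q_prim); apply: contra ii'.
  rewrite !modn_small => [/eqP h||]; first exact/eqP/val_inj.
    by rewrite -[X in (_ < X)%N](Zp_cast e_gt1).
  by rewrite -[X in (_ < X)%N](Zp_cast e_gt1).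
have sc c z z' : GRing.comm z z' -> GRing.comm (c%:S * z : A) z'.
  by move=> zz'; apply/commr_sym/commrM; [exact/commr_sym/comm_scal | exact/commr_sym].
have sn c z : nilpotent z -> nilpotent (c%:S * z : A).
  by move=> nz; rewrite scalC; apply: nilpotentM => //; exact/commr_sym/comm_scal.
apply: nilpotentD; [|exact: sn|exact/nilpotentN/sn].
by apply/commrN/sc/commr_sym/sc.
Qed.

Lemma invertible_yIV i i' y y' : GRing.comm y y' -> nilpotent y -> nilpotent y' ->
  i != i' -> invertible (1 - yI q i y * rinv (yI q i' y')).
Proof.
move=> yy' ny ny' ii'; have h' := invertible_yI i' ny'.
have -> : 1 - yI q i y * rinv (yI q i' y') =
    (yI q i' y' - yI q i y) * rinv (yI q i' y').
  by rewrite mulrBl (rinvP h').1.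
apply: invertibleM; last exact: invertible_rinv.
by apply: invertible_yIB => //; rewrite eq_sym.
Qed.
End SeriesUnits.

(* T will be an intertwining relation x u = u z, or the relation of an element of
   a tensor factor with its image in a corner. *)
Section SeriesTransport.
Variables (F : fieldType) (e : nat) (q : F) (A B : pzAlgType F).
Variable T : A -> B -> Prop.
Hypotheses (T1 : T 1 1) (TB : forall x x' y y', T x x' -> T y y' -> T (x - y) (x' - y'))
  (TM : forall x x' y y', T x x' -> T y y' -> T (x * y) (x' * y'))
  (TS : forall c, T c%:S c%:S)
  (TV : forall x x', invertible x -> invertible x' -> T x x' -> T (rinv x) (rinv x')).
Hypotheses (e_gt1 : (1 < e)%N) (q_prim : e.-primitive_root q).
Variables (y y' : A) (z z' : B).
Hypotheses (yy' : GRing.comm y y') (zz' : GRing.comm z z') (ny : nilpotent y)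
  (ny' : nilpotent y') (nz : nilpotent z) (nz' : nilpotent z').
Hypotheses (Tyz : T y z) (Tyz' : T y' z').

Let T_yI (i : 'Z_e) : T (yI q i y) (yI q i z).
Proof. exact/TM/TB. Qed.
Let T_yI' (i : 'Z_e) : T (yI q i y') (yI q i z').
Proof. exact/TM/TB. Qed.

Lemma Qser_transport (i i' : 'Z_e) : T (Qser q i i' y y') (Qser q i i' z z').
Proof.
(* Stability under subtraction gives 0 = 1 - 1, hence opposites and sums. *)
have TD u u' v v' : T u u' -> T v v' -> T (u + v) (u' + v').
  move=> h h'; rewrite -[v]opprK -[v']opprK; apply: TB => //.
  have T0 : T 0 0 by have := TB T1 T1; rewrite !subrr.
  by rewrite -[- v]sub0r -[- v']sub0r; exact: TB.
rewrite /Qser; have [_|ii'] := ifPn (i == i').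
  by apply: TB => //; apply: TD; [exact: TB | exact: TM].
have h := invertible_yIB e_gt1 q_prim yy' ny ny' ii'.
have h' := invertible_yIB e_gt1 q_prim zz' nz nz' ii'.
have Tn : T (yI q i y - q%:S * yI q i' y') (yI q i z - q%:S * yI q i' z').
  by apply: TB => //; exact: TM.
have Td : T (yI q i y - yI q i' y') (yI q i z - yI q i' z') by exact: TB.
case: ifP => _; first by apply: TM => //; apply: TV; rewrite ?expr2;
  [exact: invertibleM|exact: invertibleM|exact: TM].
by do 2?case: ifP => _ //; apply: TM => //; exact: TV.
Qed.

Lemma Pser_transport (i i' : 'Z_e) : T (Pser q i i' y y') (Pser q i i' z z').
Proof.
rewrite /Pser; have [_ //|ii'] := ifPn (i == i').
apply: TM => //; apply: TV; [exact: invertible_yIV|exact: invertible_yIV|].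
by apply: TB => //; apply: TM => //; apply: TV => //; exact: invertible_yI.
Qed.
End SeriesTransport.

(** * Quiver Hecke relations *)

(* Stated for abstract rings, because conversion between distinct products of
   generators of a free algebra is costly. *)
Section RelationImages.
Variables (A B : pzRingType) (f : {rmorphism A -> B}).
Variables (x x' y y' z u : A) (N : nat).

Lemma rmorph_rel2 : f (x * y) = f (x' * y') -> f x * f y = f x' * f y'.
Proof. by rewrite !rmorphM. Qed.

Lemma rmorph_rel3 : f (x * y * z) = f ((y' * x' + N%:R) * z) ->
  f x * f y * f z = (f y' * f x' + N%:R) * f z.
Proof. by rewrite !rmorphM rmorphD rmorphM rmorph_nat. Qed.

Lemma rmorph_relX0 : f (x ^+ N * z) = f 0 -> f x ^+ N * f z = 0.
Proof. by rewrite rmorphM rmorphXn rmorph0. Qed.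

Lemma rmorph_relX1 : f (x ^+ N * z) = f z -> f x ^+ N * f z = f z.
Proof. by rewrite rmorphM rmorphXn. Qed.

Lemma rmorph_relXB : f (x ^+ N * z) = f ((y - y') * z) ->
  f x ^+ N * f z = (f y - f y') * f z.
Proof. by rewrite !rmorphM rmorphXn rmorphB. Qed.

Lemma rmorph_relXBB : f (x ^+ N * z) = f ((y - y') * (y' - y) * z) ->
  f x ^+ N * f z = (f y - f y') * (f y' - f y) * f z.
Proof. by rewrite !rmorphM rmorphXn !rmorphB. Qed.

Lemma rmorph_rel4 : u = 0 -> f (x * y * x * z) = f ((y * x * y + u) * z) ->
  f x * f y * f x * f z = f y * f x * f y * f z.
Proof. by move=> ->; rewrite addr0 !rmorphM. Qed.

Lemma rmorph_relif (b : bool) : f (x * y) = f (if b then x else 0) ->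
  f x * f y = if b then f x else 0.
Proof. by rewrite rmorphM => ->; case: b; rewrite ?rmorph0. Qed.
End RelationImages.

Section QuiverFamily.
Variables (V : finType) (edge : rel V) (L : V -> nat) (m : nat).
Variables (H : pzRingType) (e_ : {ffun 'I_m -> V} -> H) (y : 'I_m -> H) (psi : 'I_m.-1 -> H).
Local Notation word := {ffun 'I_m -> V}.
Implicit Types (k : word) (a b : 'I_m.-1).

(** The quiver Hecke relations as a property of elements of an arbitrary ring, so that the
    presentation is never unfolded afterwards. The braid relation is recorded for the words k on
    which its error term vanishes. *)
Record quiver_family : Prop := QuiverFamily {
  sum_Qe : \sum_k e_ k = 1;
  Qe_mul : forall (k k' : word), e_ k * e_ k' = if k == k' then e_ k else 0;
  Qy_e : forall (c : 'I_m) (k : word), y c * e_ k = e_ k * y c;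
  Qpsi_e : forall (a : 'I_m.-1) (k : word), psi a * e_ k = e_ (pact (sadj a) k) * psi a;
  Qyy : forall (c c' : 'I_m), y c * y c' = y c' * y c;
  Qpsi_y : forall (a : 'I_m.-1) (c : 'I_m), c != lpos a -> c != rpos a ->
    psi a * y c = y c * psi a;
  Qpsi_far : forall (a b : 'I_m.-1), (a.+1 < b)%N || (b.+1 < a)%N ->
    psi a * psi b = psi b * psi a;
  Qpsi_yr : forall (a : 'I_m.-1) (k : word), psi a * y (rpos a) * e_ k
    = (y (lpos a) * psi a + (k (lpos a) == k (rpos a))%:R) * e_ k;
  Qy_psi : forall (a : 'I_m.-1) (k : word), y (rpos a) * psi a * e_ k
    = (psi a * y (lpos a) + (k (lpos a) == k (rpos a))%:R) * e_ k;
  Qpsi_sq_eq : forall (a : 'I_m.-1) (k : word), k (lpos a) = k (rpos a) -> psi a ^+ 2 * e_ k = 0;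
  Qpsi_sq_unlinked : forall (a : 'I_m.-1) (k : word), unlinked edge (k (lpos a)) (k (rpos a)) ->
    psi a ^+ 2 * e_ k = e_ k;
  Qpsi_sq_to : forall (a : 'I_m.-1) (k : word), arrow edge (k (lpos a)) (k (rpos a)) ->
    psi a ^+ 2 * e_ k = (y (rpos a) - y (lpos a)) * e_ k;
  Qpsi_sq_from : forall (a : 'I_m.-1) (k : word), arrow edge (k (rpos a)) (k (lpos a)) ->
    psi a ^+ 2 * e_ k = (y (lpos a) - y (rpos a)) * e_ k;
  Qpsi_sq_both : forall (a : 'I_m.-1) (k : word), biarrow edge (k (lpos a)) (k (rpos a)) ->
    psi a ^+ 2 * e_ k =
    (y (rpos a) - y (lpos a)) * (y (lpos a) - y (rpos a)) * e_ k;
  Qpsi_braid : forall (a b : 'I_m.-1) (k : word), b = a.+1 :> nat ->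
    ~~ [&& k (rpos b) == k (lpos a)
    & edge (k (lpos a)) (k (rpos a)) || edge (k (rpos a)) (k (lpos a))] ->
    psi b * psi a * psi b * e_ k = psi a * psi b * psi a * e_ k;
  Qcyc : forall (c : 'I_m) (k : word), c = 0%N :> nat -> y c ^+ L (k c) * e_ k = 0
}.

Hypothesis fam : quiver_family.

Lemma Qy_e_comm (c : 'I_m) k : GRing.comm (y c) (e_ k).
Proof. exact: (Qy_e fam). Qed.

Lemma eq_Qe (x x' : H) : (forall k, x * e_ k = x' * e_ k) -> x = x'.
Proof.
move=> h; rewrite -[x]mulr1 -[x']mulr1 -(sum_Qe fam) !mulr_sumr.
by apply: eq_bigr => k _.
Qed.

Lemma pact_sadjK a : involutive (@pact m V (sadj a)).
Proof. by move=> k; apply/ffunP => i; rewrite !ffunE /sadj tpermV tpermK. Qed.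

Lemma Qpsi_y_neq a (c : 'I_m) k : k (lpos a) != k (rpos a) ->
  psi a * y c * e_ k = y (sadj a c) * psi a * e_ k.
Proof.
move=> /negbTE ne; rewrite /sadj; case: tpermP => [->|->|/eqP h1 /eqP h2].
- by rewrite (Qy_psi fam) ne addr0.
- by rewrite (Qpsi_yr fam) ne addr0.
- by rewrite (Qpsi_y fam).
Qed.

Lemma Qpsi_yX_neq a (c : 'I_m) k N : k (lpos a) != k (rpos a) ->
  psi a * y c ^+ N * e_ k = y (sadj a c) ^+ N * psi a * e_ k.
Proof.
move=> ne; elim: N => [|N IH]; first by rewrite !expr0 mulr1 mul1r.
rewrite exprSr mulrA -(mulrA (psi a * _)) (Qy_e fam) mulrA IH -!mulrA -(Qy_e fam).
by rewrite (mulrA (psi a)) Qpsi_y_neq// !mulrA -exprSr.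
Qed.

Lemma nilpotent_sum_e (x : H) : (forall k, GRing.comm x (e_ k)) ->
  (forall k, exists N, x ^+ N * e_ k = 0) -> nilpotent x.
Proof.
move=> xe h; pose N k := projT1 (cid (h k)).
exists (\sum_k N k)%N; apply: eq_Qe => k; rewrite mul0r.
by rewrite (bigD1 k)//= addnC exprD -mulrA /N; case: (cid _) => ? /= ->; rewrite mulr0.
Qed.

(** Write Y, Y' for y_a, y_{a+1} and D = Y' - Y. Since psi_a exchanges the two y's, Y'^N psi_a^2
    e(k) contains Y^N and vanishes. As psi_a^2 e(k) is e(k), D e(k) or -D e(k), or -D^2 e(k), in
    every case D^2 Y'^N e(k) = 0. *)
Lemma Qy_nil_neq a k N : k (lpos a) != k (rpos a) -> y (lpos a) ^+ N = 0 ->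
  exists M, y (rpos a) ^+ M * e_ k = 0.
Proof.
set Y := y (lpos a); set Y' := y (rpos a) => ne YN.
have YY' : GRing.comm Y Y' by exact: (Qyy fam).
have [D [YE YD]] : exists D, Y' = Y + D /\ GRing.comm Y D.
  exists (Y' - Y); split; first by rewrite addrC subrK.
  exact/commrB/commr_refl.
have sq : Y' ^+ N * (psi a ^+ 2 * e_ k) = 0.
  rewrite expr2 -mulrA (Qpsi_e fam) !mulrA -(mulrA (Y' ^+ N)) (Qpsi_e fam).
  rewrite mulrA -[_ ^+ N * _ * psi a]mulrA -(Qpsi_e fam) mulrA.
  have := @Qpsi_yX_neq a (lpos a) (pact (sadj a) k) N.
  rewrite {4}/sadj tpermL -/Y -/Y' YN mulr0 mul0r => <- //.
    by rewrite mul0r.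
  by rewrite !ffunE /sadj tpermV tpermL tpermR eq_sym.
have Y'D : GRing.comm Y' D by rewrite YE; exact/commr_sym/commrD/commr_refl/commr_sym.
suff D2 : D ^+ 2 * Y' ^+ N * e_ k = 0.
  (* In (Y + D)^(N+1) Y'^N e(k), the terms with D^i, i >= 2, are killed by [D2]; the exponent N + 1
     ensures that the two remaining ones contain Y^N. *)
  exists (N.+1 + N)%N; rewrite exprD YE exprDn_comm// -YE mulr_suml mulr_suml big1// => i _.
  have [i2|i1] := leqP 2 i.
    have Di : D ^+ i * (Y' ^+ N * e_ k) = 0.
      by rewrite -(subnK i2) exprD -mulrA [X in _ * X]mulrA D2 mulr0.
    by rewrite !mulrnAl -!mulrA Di mulr0 mul0rn.
  have NI : (N <= N.+1 - i)%N by case: (nat_of_ord i) i1 => [|[|]] // _; rewrite ?subSS subn0.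
  by rewrite -(subnKC NI) exprD YN !mul0r mul0rn !mul0r.
have DY' : GRing.comm (D ^+ 2) (Y' ^+ N) by exact/commrX/commr_sym/commrX/commr_sym.
have cD : D * Y' ^+ N = Y' ^+ N * D by exact/commrX/commr_sym.
rewrite DY'; move: sq; have [u|nu] := boolP (unlinked edge (k (lpos a)) (k (rpos a))).
  by rewrite (Qpsi_sq_unlinked fam)// -DY' -mulrA => ->; rewrite mulr0.
have ED : Y' - Y = D by rewrite YE addrC addKr.
have [t|nt] := boolP (arrow edge (k (lpos a)) (k (rpos a))).
  rewrite (Qpsi_sq_to fam)// -/Y -/Y' ED => h.
  by rewrite expr2 mulrA -cD -!mulrA h mulr0.
have [f|nf] := boolP (arrow edge (k (rpos a)) (k (lpos a))).
  rewrite (Qpsi_sq_from fam)// -/Y -/Y' -opprB ED mulNr mulrN => /eqP; rewrite oppr_eq0 => /eqP h.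
  by rewrite expr2 mulrA -cD -!mulrA h mulr0.
rewrite (Qpsi_sq_both fam).
  rewrite -/Y -/Y' -(opprB Y' Y) ED mulrN mulNr mulrN mulrA => /eqP; rewrite oppr_eq0 => /eqP.
  by rewrite mulrA.
by move: nu nt nf; rewrite /unlinked /arrow /biarrow ne; do 2!case: (edge _ _).
Qed.
End QuiverFamily.

Section QHeckeFamily.
Variables (F : fieldType) (V : finType) (edge : rel V) (L : V -> nat) (m : nat).
Local Notation H := (QHecke F edge L m).
Local Notation pi := (ppi (@qrel F V edge L m)).

Lemma QHecke_family : @quiver_family V edge L m H
  (@Qe F V edge L m) (@Qy F V edge L m) (@Qpsi F V edge L m).
Proof.
split.
- have piS (I : finType) (f : I -> falg F (qgen V m)) : \sum_i pi (f i) = pi (\sum_i f i).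
    by rewrite raddf_sum.
  by rewrite piS (palg_rel (qrel_sum F edge L _)).
- move=> k k'; exact: (@rmorph_relif _ _ pi _ _ _ (palg_rel (qrel_EE F edge L k k'))).
- move=> c k; exact: (@rmorph_rel2 _ _ pi _ _ _ _ (palg_rel (qrel_yE F edge L c k))).
- move=> a k; exact: (@rmorph_rel2 _ _ pi _ _ _ _ (palg_rel (qrel_psiE F edge L a k))).
- move=> c c'; exact: (@rmorph_rel2 _ _ pi _ _ _ _ (palg_rel (qrel_yy F edge L c c'))).
- move=> a c h h'; exact: (@rmorph_rel2 _ _ pi _ _ _ _ (palg_rel (qrel_psiy F edge L h h'))).
- move=> a b h; exact: (@rmorph_rel2 _ _ pi _ _ _ _ (palg_rel (qrel_far F edge L h))).
- move=> a k; exact: (@rmorph_rel3 _ _ pi _ _ _ _ _ _ (palg_rel (qrel_psiyr F edge L a k))).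
- move=> a k; exact: (@rmorph_rel3 _ _ pi _ _ _ _ _ _ (palg_rel (qrel_ypsi F edge L a k))).
- move=> a k h; exact: (@rmorph_relX0 _ _ pi _ _ _ (palg_rel (qrel_sq_eq F edge L h))).
- move=> a k h; exact: (@rmorph_relX1 _ _ pi _ _ _ (palg_rel (qrel_sq_unlinked F L h))).
- move=> a k h; exact: (@rmorph_relXB _ _ pi _ _ _ _ _ (palg_rel (qrel_sq_to F L h))).
- move=> a k h; exact: (@rmorph_relXB _ _ pi _ _ _ _ _ (palg_rel (qrel_sq_from F L h))).
- move=> a k h; exact: (@rmorph_relXBB _ _ pi _ _ _ _ _ (palg_rel (qrel_sq_both F L h))).
- move=> a b k ba h; apply: (@rmorph_rel4 _ _ pi _ _ _ _ _ (palg_rel (qrel_braid F edge L k ba))).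
  by move: h; rewrite /arrow /biarrow; case: eqP => // _; do 2!case: (edge _ _).
- move=> c k h; exact: (@rmorph_relX0 _ _ pi _ _ _ (palg_rel (qrel_cyc F edge L k h))).
Qed.
End QHeckeFamily.

(* In the nil Hecke algebra, h n is the complete symmetric polynomial of degree
   n - 1: P z^n = y^n P + h n and (z - y) h n = z^n - y^n; applying P to
   h (N + 1) = z h N, where y^N = 0, gives h N = 0. *)
Lemma nilHecke_nil (A : pzRingType) (y z P E : A) (N : nat) :
  y * z = z * y -> E * y = y -> y * E = y -> E * z = z -> z * E = z -> E * E = E ->
  P * z = y * P + E -> P * P = 0 -> y ^+ N = 0 -> z ^+ N.+1 = 0.
Proof.
move=> yz Ey yE Ez zE EE Pz PP yN.
pose h := fix h n := if n is n'.+1 then z * h n' + y ^+ n' * E else 0.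
have hS n : h n.+1 = z * h n + y ^+ n * E by [].
have yXE n : E * (y ^+ n * E) = y ^+ n * E.
  by case: n => [|n]; rewrite ?mul1r// exprS !mulrA Ey.
have Eh n : E * h n = h n.
  by elim: n => [|n IH]; rewrite ?mulr0// hS mulrDr !mulrA Ez -mulrA yXE.
have hz n : h n * z = z * h n.
  elim: n => [|n IH]; first by rewrite mul0r mulr0.
  rewrite hS mulrDl mulrDr -mulrA IH; congr (_ + _).
  by rewrite -mulrA Ez mulrA (commrX n (commr_sym yz)) -mulrA zE.
have Pzn n : P * z ^+ n = y ^+ n * P + h n.
  elim: n => [|n IH]; first by rewrite mulr1 mul1r addr0.
  by rewrite exprSr mulrA IH mulrDl -mulrA Pz mulrDr mulrA -exprSr hz hS addrAC addrA.
have hS' n : h n.+1 = y * h n + z ^+ n * E.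
  elim: n => [|n IH]; first by rewrite hS !mulr0.
  by rewrite hS {1}IH hS !mulrDr !mulrA -yz -!exprS addrAC.
have hN0 : h N = 0.
  have PhN n : (N <= n)%N -> P * h n = 0.
    move=> /subnK nN; have yn : y ^+ n = 0 by rewrite -nN exprD yN mulr0.
    have := Pzn n; rewrite yn mul0r add0r => <-.
    by rewrite mulrA PP mul0r.
  have := PhN N.+1 (leqnSn N); rewrite hS yN mul0r addr0 mulrA Pz mulrDl.
  by rewrite -mulrA PhN// mulr0 add0r Eh.
have := hS' N; rewrite hS hN0 !mulr0 !add0r yN mul0r => zN.
by rewrite exprSr -[X in _ * X]Ez mulrA -zN mul0r.
Qed.

(** * Nilpotency of the y's *)

Section YNilpotent.
Variables (V : finType) (edge : rel V) (L : V -> nat) (m : nat).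
Variables (H : pzRingType) (e_ : {ffun 'I_m -> V} -> H) (y : 'I_m -> H) (psi : 'I_m.-1 -> H).
Hypothesis fam : quiver_family edge L e_ y psi.

(** As s_a k = k, psi_a commutes with e(k); then y_a e(k), y_{a+1} e(k) and psi_a e(k) satisfy the
    nil Hecke relations with e(k) as unit. *)
Lemma Qy_nil_eq a (k : {ffun 'I_m -> V}) N : k (lpos a) = k (rpos a) ->
  y (lpos a) ^+ N = 0 -> y (rpos a) ^+ N.+1 * e_ k = 0.
Proof.
move=> kk yN; have sk : pact (sadj a) k = k.
  by apply/ffunP => i; rewrite ffunE /sadj tpermV; case: tpermP => [->|->|].
have pe : psi a * e_ k = e_ k * psi a by rewrite (Qpsi_e fam) sk.
have ee : e_ k * e_ k = e_ k by rewrite (Qe_mul fam) eqxx.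
have ye c : y c * e_ k = e_ k * y c by exact: Qy_e fam _ _.
have yeX c n : (y c * e_ k) ^+ n.+1 = y c ^+ n.+1 * e_ k.
  rewrite exprMn_comm; last exact: ye.
  by congr (_ * _); elim: n => [|n IH]; rewrite ?expr1// exprS IH ee.
(* For N = 0 the hypothesis reads 1 = 0 and the ring is trivial; [yeX] speaks of positive
   exponents. *)
case: N yN => [|N] yN; first by rewrite -[y _ ^+ 1]mul1r -[1](expr0 (y (lpos a))) yN !mul0r.
rewrite -yeX; apply: (@nilHecke_nil _ (y (lpos a) * e_ k) _ (psi a * e_ k) (e_ k)).
- by rewrite -!mulrA (mulrA (e_ k)) -ye !mulrA (Qyy fam) -!mulrA (mulrA (e_ k) (y _)) -ye -!mulrA.
- by rewrite mulrA -ye -mulrA ee.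
- by rewrite -mulrA ee.
- by rewrite mulrA -ye -mulrA ee.
- by rewrite -mulrA ee.
- exact: ee.
- rewrite !mulrA -[psi a * _ * _]mulrA -ye -!mulrA ee mulrA (Qpsi_yr fam) kk eqxx mulrDl mul1r.
  by rewrite -!mulrA (mulrA (e_ k) (psi a)) -pe -!mulrA ee.
- by rewrite -!mulrA (mulrA (e_ k)) -pe -!mulrA ee mulrA -expr2 (Qpsi_sq_eq fam).
- by rewrite yeX yN mul0r.
Qed.

(** Induction on the index, started by the cyclotomic relation. The exponent obtained depends on k,
    and the finitely many exponents are added up. *)
Lemma Qy_nilpotent (c : 'I_m) : nilpotent (y c).
Proof.
case: c; elim=> [|c IH] cm.
  apply: (nilpotent_sum_e fam) => k; first exact: (Qy_e_comm fam).
  by exists (L (k (Ordinal cm))); rewrite (Qcyc fam).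
have cm1 : (c < m.-1)%N by rewrite ltn_predRL.
pose a : 'I_m.-1 := Ordinal cm1.
have <- : rpos a = Ordinal cm by exact: val_inj.
have [N yN] := IH (ltnW cm).
have {}yN : y (lpos a) ^+ N = 0 by rewrite -yN; congr (y _ ^+ _); exact: val_inj.
apply: (nilpotent_sum_e fam) => k; first exact: (Qy_e_comm fam).
have [kk|ne] := eqVneq (k (lpos a)) (k (rpos a)); last exact: (Qy_nil_neq fam ne yN).
by exists N.+1; exact: Qy_nil_eq.
Qed.
End YNilpotent.

(** * Words sorting a colour word *)

Section ColourWords.
Variables n d : nat.
Local Notation word := {ffun 'I_n -> 'I_d}.
Implicit Types (t : word) (a b c : 'I_n.-1) (p : seq 'I_n.-1).

Definition inversions t : nat := (\sum_(x : 'I_n * 'I_n | x.1 < x.2) (t x.2 < t x.1))%N.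

(** s_a permutes the pairs i < j other than (a, a + 1), so that only this pair can change. The
    additive form avoids truncated subtraction. *)
Lemma inversions_step t a :
  (inversions t + (t (lpos a) < t (rpos a)) =
   inversions (pact (sadj a) t) + (t (rpos a) < t (lpos a)))%N.
Proof.
pose s := sadj a; pose l := lpos a; pose r := rpos a.
have sV : (s^-1)%g = s by rewrite /s /sadj tpermV.
have lr : l != r by rewrite -val_eqE /= ltn_eqF.
have E1 : (inversions t = \sum_(x : 'I_n * 'I_n) (x.1 < x.2) * (t x.2 < t x.1))%N.
  by rewrite /inversions big_mkcond /=; apply: eq_bigr => x _; case: ifP; rewrite ?mul1n.
have E2 : (inversions (pact s t) =
    \sum_(x : 'I_n * 'I_n) (s x.1 < s x.2) * (t x.2 < t x.1))%N.
  rewrite /inversions big_mkcond (reindex (fun x : 'I_n * 'I_n => (s x.1, s x.2))) /=.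
    by apply: eq_bigr => x _; rewrite !ffunE !permK; case: ifP; rewrite ?mul1n.
  by exists (fun x => (s x.1, s x.2)) => -[x y] _; rewrite /= -{1 3}sV !permK.
rewrite {}E1 {}E2 (bigD1 (l, r))//= (bigD1 (r, l))/=; last by rewrite xpair_eqE negb_and eq_sym lr.
rewrite [in RHS](bigD1 (l, r))//= [in RHS](bigD1 (r, l))/=; last first.
  by rewrite xpair_eqE negb_and eq_sym lr.
have -> : s l = r by rewrite /s /sadj tpermL.
have -> : s r = l by rewrite /s /sadj tpermR.
have lr1 : (l < r)%N by exact: ltnSn.
have rl0 : (r < l)%N = false by apply/negbTE; rewrite -leqNgt ltnW.
rewrite lr1 rl0 !mul1n !mul0n !add0n addnAC [in RHS]addnAC.
congr (_ + _)%N; first exact: addnC.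
apply: eq_bigr => -[x y] /=.
rewrite !xpair_eqE -!val_eqE /= => h; congr (_ * _)%N; congr nat_of_bool.
rewrite /s /sadj; case: tpermP => [ex|ex|/eqP hx1 /eqP hx2];
  case: tpermP => [ey|ey|/eqP hy1 /eqP hy2]; move: h; rewrite ?ex ?ey;
  try move: hx1 hx2; try move: hy1 hy2; rewrite -?val_eqE /=; lia.
Qed.

Lemma inversions_descent t a : (t (rpos a) < t (lpos a))%N ->
  inversions t = (inversions (pact (sadj a) t)).+1.
Proof.
move=> h; have := inversions_step t a.
by rewrite h ltnNge ltnW//= addn0 addn1.
Qed.

Lemma inversions_le t a : (inversions t <= (inversions (pact (sadj a) t)).+1)%N.
Proof. by have := inversions_step t a; do 2!case: ltnP; rewrite /=; lia. Qed.

Lemma inversions0_mono t (i j : 'I_n) : inversions t = 0%N -> (i <= j)%N -> (t i <= t j)%N.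
Proof.
move=> t0; rewrite leq_eqVlt => /orP[/eqP ij|ij]; first by rewrite (val_inj ij).
move/eqP: t0; rewrite /inversions sum_nat_eq0 => /forallP/(_ (i, j)) /=.
by rewrite ij /= eqb0 -leqNgt.
Qed.

Lemma descent_exists t : (0 < inversions t)%N -> exists a, (t (rpos a) < t (lpos a))%N.
Proof.
move=> t0; apply/existsP; apply: contraLR t0; rewrite negb_exists => /forallP h.
rewrite -eqn0Ngt sum_nat_eq0; apply/forallP => -[i j] /=; apply/implyP => ij.
rewrite eqb0 -leqNgt; have [k] := ubnP (j - i)%N.
elim: k j ij => // k IH [[|j] jn] //= ij ltk.
have jn1 : (j < n.-1)%N by rewrite ltn_predRL.
have := h (Ordinal jn1); rewrite -leqNgt.
rewrite [rpos _](_ : _ = Ordinal jn); last exact: val_inj.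
move: ij; rewrite ltnS leq_eqVlt => /orP[/eqP ij|ij].
  by rewrite [lpos _](_ : _ = i)//; exact: val_inj.
apply: leq_trans; rewrite [lpos _](_ : _ = Ordinal (ltnW jn)); last exact: val_inj.
by apply: IH => //=; lia.
Qed.

(** The head of p acts first on t. Hence the permutation that sorts t is [wperm (rev p)], with
    inverse [wperm p], and the product attached to it in the algebra is that of [rev p]. *)
Fixpoint down t p : bool :=
  if p is a :: p' then (t (rpos a) < t (lpos a))%N && down (pact (sadj a) t) p'
  else inversions t == 0%N.

Lemma down_size t p : down t p -> size p = inversions t.
Proof.
elim: p t => [|a p IH] t /=; first by move/eqP.
by case/andP => h /IH ->; rewrite (inversions_descent h).
Qed.

Lemma down_exists t : exists p, down t p.
Proof.
have [k] := ubnP (inversions t); elim: k t => // k IH t ltk.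
have [t0|t0] := posnP (inversions t); first by exists [::]; apply/eqP.
have [a ta] := descent_exists t0.
have [|p dp] := IH (pact (sadj a) t); last by exists (a :: p); rewrite /= ta.
by rewrite (inversions_descent ta) in ltk.
Qed.

Lemma pactM (T : Type) (s r : 'S_n) (x : {ffun 'I_n -> T}) :
  pact s (pact r x) = pact (r * s)%g x.
Proof. by apply/ffunP => i; rewrite !ffunE invMg permM. Qed.

Lemma pact1 (T : Type) (x : {ffun 'I_n -> T}) : pact 1%g x = x.
Proof. by apply/ffunP => i; rewrite !ffunE invg1 perm1. Qed.

Lemma wperm_rev_cons a p : wperm (rev (a :: p)) = (sadj a * wperm (rev p))%g.
Proof. by rewrite rev_cons -cats1 wperm_cat /= mul1g. Qed.

Lemma wperm_rev p : wperm (rev p) = ((wperm p)^-1)%g.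
Proof.
elim: p => [|a p IH]; first by rewrite /= invg1.
by rewrite wperm_rev_cons IH /= invMg /sadj tpermV.
Qed.

Lemma pact_wperm_cons (T : Type) a p (x : {ffun 'I_n -> T}) :
  pact (wperm (rev (a :: p))) x = pact (wperm (rev p)) (pact (sadj a) x).
Proof. by rewrite wperm_rev_cons pactM. Qed.

Lemma inversions_le_size t p : inversions (pact (wperm (rev p)) t) = 0%N ->
  (inversions t <= size p)%N.
Proof.
elim: p t => [|a p IH] t; first by rewrite /= pact1 => ->.
rewrite pact_wperm_cons => /IH; move: (inversions_le t a) => /= h h'.
exact: leq_trans h _.
Qed.

(** A letter removes at most one inversion; a sorting word with exactly as many letters as t has
    inversions must remove one at each step. *)
Lemma down_minimal t p : inversions (pact (wperm (rev p)) t) = 0%N ->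
  size p = inversions t -> down t p.
Proof.
elim: p t => [|a p IH] t; first by rewrite /= => _ <-.
rewrite pact_wperm_cons /= => h st; have := inversions_le_size h.
have := inversions_step t a; rewrite -st; case: ltnP => // h1.
  by rewrite ltnNge ltnW//=; lia.
case: ltnP => /= h2; last by lia.
by move=> e1 _; apply: IH => //; lia.
Qed.

Lemma down_sorted t p : down t p -> inversions (pact (wperm (rev p)) t) = 0%N.
Proof.
elim: p t => [|a p IH] t; first by rewrite /= pact1 => /eqP.
by rewrite pact_wperm_cons => /= /andP[_ /IH].
Qed.

Lemma sadj_far a b : (a.+1 < b)%N -> (sadj a * sadj b = sadj b * sadj a)%g.
Proof.
move=> ab; rewrite [RHS]conjgC; congr (_ * _)%g.
by rewrite tpermJ /sadj !tpermD// -val_eqE /=; lia.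
Qed.

Lemma rpos_lpos a b : b = a.+1 :> nat -> rpos a = lpos b.
Proof. by move=> ba; apply: val_inj; rewrite /= ba. Qed.

Lemma sadj_braid a b : b = a.+1 :> nat ->
  (sadj a * sadj b * sadj a = sadj b * sadj a * sadj b)%g.
Proof.
move=> ba; have e := rpos_lpos ba.
have -> : (sadj a * sadj b * sadj a = sadj b ^ sadj a)%g.
  by rewrite conjgE /sadj tpermV mulgA.
have -> : (sadj b * sadj a * sadj b = sadj a ^ sadj b)%g.
  by rewrite conjgE /sadj tpermV mulgA.
rewrite !tpermJ /sadj -e tpermR tpermL !tpermD// -val_eqE /=; lia.
Qed.

Lemma pact_sadj_far (T : Type) (x : {ffun 'I_n -> T}) a b : (a.+1 < b)%N ->
  pact (sadj a) (pact (sadj b) x) = pact (sadj b) (pact (sadj a) x).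
Proof. by move=> ab; rewrite !pactM (sadj_far ab). Qed.

Lemma pact_sadj_braid (T : Type) (x : {ffun 'I_n -> T}) a b : b = a.+1 :> nat ->
  pact (sadj a) (pact (sadj b) (pact (sadj a) x)) =
  pact (sadj b) (pact (sadj a) (pact (sadj b) x)).
Proof. by move=> ba; rewrite !pactM !mulgA (sadj_braid ba). Qed.

Lemma pact_sadjE (T : Type) (x : {ffun 'I_n -> T}) a i :
  pact (sadj a) x i = x (sadj a i).
Proof. by rewrite ffunE /sadj tpermV. Qed.

(* Newman's lemma: two descents a and b of t are joined by the commutation of s_a
   and s_b, or by the braid relation. *)
Lemma down_confluent (X : Type) (f : word -> seq 'I_n.-1 -> X) :
  (forall t a p p', f (pact (sadj a) t) p = f (pact (sadj a) t) p' ->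
     f t (a :: p) = f t (a :: p')) ->
  (forall t a b p, (a.+1 < b)%N -> f t (a :: b :: p) = f t (b :: a :: p)) ->
  (forall t a b p, b = a.+1 :> nat -> (t (rpos b) < t (lpos a))%N ->
     f t (a :: b :: a :: p) = f t (b :: a :: b :: p)) ->
  forall t p p', down t p -> down t p' -> f t p = f t p'.
Proof.
move=> cong far braid t p p'.
have [k] := ubnP (size p); elim: k t p p' => // k IH t p p'.
case: p p' => [|a p] [|b p'] //= szp.
- by move=> /eqP t0 /andP[h _]; rewrite (inversions_descent h) in t0.
- by move=> /andP[h _] /eqP t0; rewrite (inversions_descent h) in t0.
(* The bound on the size concerns the first word only; the exchange is legitimate because both words
   have size [inversions t]. *)
wlog ab : a b p p' szp / (a <= b)%N => [hw|].
  have [|/ltnW] := leqP a b; first exact: hw.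
  move=> ba dp dp'; apply/esym/hw => //.
  case/andP: dp dp' => ta /down_size sp /andP[tb /down_size sp'].
  rewrite sp'; move: (inversions_descent ta) (inversions_descent tb).
  by rewrite -sp => -> [<-].
case/andP => ta dp /andP[tb dp'].
have IH' t' r r' : (size r < k)%N -> down t' r -> down t' r' -> f t' r = f t' r' by exact: IH.
have szp' : size p' = size p.
  move: (inversions_descent ta) (inversions_descent tb).
  by rewrite -(down_size dp) -(down_size dp') => -> [].
have [abE|nab] := eqVneq a b.
  by rewrite -abE in dp' *; apply: cong; exact: IH'.
have {nab} ltab : (a < b)%N by rewrite ltn_neqAle ab andbT.
have [far_ab|near] := ltnP a.+1 b.
  have dist : [/\ lpos a != lpos b, rpos a != lpos b, lpos a != rpos b & rpos a != rpos b].
    by rewrite -!val_eqE /=; split; lia.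
  case: dist => h1 h2 h3 h4.
  (* The two branches meet at s_b s_a t, which r sorts; [b :: r] and [a :: r] then complete them,
     and the induction compares these with p and p'. *)
  have [r dr] := down_exists (pact (sadj b) (pact (sadj a) t)).
  have dbr : down (pact (sadj a) t) (b :: r).
    by rewrite /= dr andbT !pact_sadjE /sadj !tpermD// eq_sym.
  have dar : down (pact (sadj b) t) (a :: r).
    by rewrite /= pact_sadj_far// dr andbT !pact_sadjE /sadj !tpermD// eq_sym.
  rewrite (cong _ _ _ (b :: r)); last exact: IH'.
  rewrite far//; apply: cong; apply: IH' => //.
  by rewrite (down_size dar) -(down_size dp') szp'.
have ba : b = a.+1 :> nat by lia.
have e := rpos_lpos ba.
have lr : rpos b != lpos a by rewrite -val_eqE /=; lia.
have sal : sadj a (lpos a) = rpos a by rewrite /sadj tpermL.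
have sar : sadj a (rpos a) = lpos a by rewrite /sadj tpermR.
have sab : sadj a (rpos b) = rpos b by rewrite /sadj tpermD// -val_eqE /=; lia.
have sba : sadj b (lpos a) = lpos a by rewrite /sadj tpermD// -val_eqE /=; lia.
have sbl : sadj b (rpos a) = rpos b by rewrite e /sadj tpermL.
have sbr : sadj b (rpos b) = rpos a by rewrite e /sadj tpermR.
(* The letters at a, a + 1, a + 2 are strictly decreasing, so both sides of the braid relation
   consist of descents and meet at the word sorted by r. *)
have tb' : (t (rpos b) < t (rpos a))%N by rewrite e.
have tba : (t (rpos b) < t (lpos a))%N by exact: ltn_trans ta.
have [r dr] := down_exists (pact (sadj a) (pact (sadj b) (pact (sadj a) t))).
have dbr : down (pact (sadj a) t) (b :: a :: r).
  by rewrite /= dr andbT !pact_sadjE -e !(sal, sar, sab, sba, sbl, sbr) tba.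
have dar : down (pact (sadj b) t) (a :: b :: r).
  by rewrite /= -pact_sadj_braid// dr andbT !pact_sadjE -e !(sal, sar, sab, sba, sbl, sbr) tba.
rewrite (cong _ _ _ (b :: a :: r)); last exact: IH'.
rewrite braid//; apply: cong; apply: IH' => //.
by rewrite (down_size dar) -(down_size dp') szp'.
Qed.

(* [glide t a p b]: along p, the letters of t at a and a + 1 travel as a pair,
   passing every other letter one after the other, and arrive at b and b + 1. *)
Inductive glide : word -> 'I_n.-1 -> seq 'I_n.-1 -> 'I_n.-1 -> Prop :=
| glide_nil t a : glide t a [::] a
| glide_far t a c p b : (a.+1 < c)%N || (c.+1 < a)%N ->
    glide (pact (sadj c) t) a p b -> glide t a (c :: p) b
| glide_adj t a c p b : (a.+1 == c)%N || (c.+1 == a)%N ->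
    t (lpos c) != t (rpos c) ->
    glide (pact (sadj a) (pact (sadj c) t)) c p b -> glide t a (c :: a :: p) b.

(** The third letter has been carried across both letters of the pair, which now sits at c and c +
    1. *)
Lemma glide_adj_pair t a c : (a.+1 == c)%N || (c.+1 == a)%N ->
  t (lpos a) = t (rpos a) ->
  pact (sadj a) (pact (sadj c) t) (lpos c) = pact (sadj a) (pact (sadj c) t) (rpos c).
Proof.
move=> adj ta.
rewrite !pact_sadjE; case/orP: adj => /eqP adj.
  have e := rpos_lpos (esym adj).
  rewrite -e.
  have -> : sadj a (rpos a) = lpos a by rewrite /sadj tpermR.
  have -> : sadj a (rpos c) = rpos c by rewrite /sadj tpermD// -val_eqE /=; lia.
  have -> : sadj c (lpos a) = lpos a by rewrite /sadj tpermD// -val_eqE /=; lia.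
  have -> : sadj c (rpos c) = rpos a by rewrite e /sadj tpermR.
  by rewrite ta.
have e := rpos_lpos (esym adj).
rewrite -e in ta *.
have -> : sadj a (lpos c) = lpos c by rewrite /sadj tpermD// -val_eqE /=; lia.
have -> : sadj a (rpos c) = rpos a by rewrite e /sadj tpermL.
have -> : sadj c (lpos c) = rpos c by rewrite /sadj tpermL.
have -> : sadj c (rpos a) = rpos a by rewrite /sadj tpermD// -val_eqE /=; lia.
by rewrite -ta.
Qed.

(** Any descent c can be used. It differs from a because the two letters there are equal. If c is
    adjacent to a, it exchanges a third letter with one member of the pair; the other member being
    equal to it, a becomes a descent in turn, and [c :: a] moves the pair by one place. *)
Lemma glide_exists t a : t (lpos a) = t (rpos a) ->
  exists p b, down t p /\ glide t a p b.
Proof.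
have [k] := ubnP (inversions t); elim: k t a => // k IH t a ltk ta.
have [t0|t0] := posnP (inversions t).
  by exists [::], a; split; [apply/eqP | exact: glide_nil].
have [c tc] := descent_exists t0; have inv1 := inversions_descent tc.
have ac : a != c by apply: contraTneq tc => <-; rewrite ta ltnn.
have [far_ac|near] := boolP ((a.+1 < c)%N || (c.+1 < a)%N).
  have [||p [b [dp gp]]] := IH (pact (sadj c) t) a; first by rewrite -ltnS -inv1.
    rewrite !pact_sadjE /sadj !tpermD//; rewrite -val_eqE /=; lia.
  by exists (c :: p), b; split; [rewrite /= tc | exact: glide_far].
have adj : (a.+1 == c)%N || (c.+1 == a)%N by move: ac near; rewrite -val_eqE /=; lia.
have tcne : t (lpos c) != t (rpos c) by rewrite -val_eqE gtn_eqF.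
suff [h1 h2] : (pact (sadj c) t (rpos a) < pact (sadj c) t (lpos a))%N /\
   pact (sadj a) (pact (sadj c) t) (lpos c) = pact (sadj a) (pact (sadj c) t) (rpos c).
  have [|p [b [dp gp]]] := IH _ _ _ h2.
    by have := inversions_descent h1; lia.
  by exists (c :: a :: p), b; split; [rewrite /= tc h1 | exact: glide_adj].
split; last exact: glide_adj_pair.
rewrite !pact_sadjE; case/orP: adj => /eqP adj; have e := rpos_lpos (esym adj).
  have -> : sadj c (lpos a) = lpos a by rewrite /sadj tpermD// -val_eqE /=; lia.
  by rewrite e {1}/sadj tpermL ta e.
have -> : sadj c (rpos a) = rpos a by rewrite /sadj tpermD// -val_eqE /=; lia.
by rewrite -e {1}/sadj tpermR -ta -e.
Qed.

Lemma glide_wperm t a p b : glide t a p b ->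
  wperm (rev p) (lpos a) = lpos b /\ wperm (rev p) (rpos a) = rpos b.
Proof.
elim=> {t a p b} [t a|t a c p b h _ [IH1 IH2]|t a c p b adj _ _ [IH1 IH2]].
- by rewrite /= !perm1.
- by rewrite !wperm_rev_cons !permM /sadj !tpermD// -val_eqE /=; lia.
rewrite !wperm_rev_cons !permM -IH1 -IH2; case/orP: adj => /eqP adj.
  have e := rpos_lpos (esym adj).
  have -> : sadj c (lpos a) = lpos a by rewrite /sadj tpermD// -val_eqE /=; lia.
  have -> : sadj c (rpos a) = rpos c by rewrite e /sadj tpermL.
  have -> : sadj a (lpos a) = lpos c by rewrite -e /sadj tpermL.
  by have -> : sadj a (rpos c) = rpos c by rewrite /sadj tpermD// -val_eqE /=; lia.
have e := rpos_lpos (esym adj).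
have -> : sadj c (lpos a) = lpos c by rewrite -e /sadj tpermR.
have -> : sadj c (rpos a) = rpos a by rewrite /sadj tpermD// -val_eqE /=; lia.
have -> : sadj a (rpos a) = rpos c by rewrite e /sadj tpermR.
by have -> : sadj a (lpos c) = lpos c by rewrite /sadj tpermD// -val_eqE /=; lia.
Qed.

Lemma wperm_down t p p' : down t p -> down t p' -> wperm p = wperm p'.
Proof.
apply: (down_confluent (f := fun _ => @wperm n)) => {t p p'} [t a p p' /= -> //||].
- by move=> t a b p ab /=; rewrite -!mulgA (sadj_far ab).
- by move=> t a b p ba _ /=; rewrite -!mulgA !(mulgA (sadj _)) sadj_braid.
Qed.
End ColourWords.

(** * Permutations of minimal length carrying t to t^lambda *)

Section MinimalPermutations.
Variables d n : nat.
Implicit Types (l : dcomp d n) (t : {ffun 'I_n -> 'I_d}) (j : 'I_d).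

Lemma shape_tlam l :
  shape [seq nseq (part l j) j | j <- enum 'I_d] = [seq part l j | j <- enum 'I_d].
Proof. by rewrite /shape -map_comp; apply: eq_map => j; rewrite /= size_nseq. Qed.

Lemma nth_part l j : nth 0%N [seq part l j | j <- enum 'I_d] j = part l j.
Proof. by rewrite (nth_map j) ?nth_ord_enum// size_enum_ord. Qed.

Lemma sumn_take_part l j : sumn (take j [seq part l j | j <- enum 'I_d]) = offset l j.
Proof.
rewrite sumnE (big_nth 0%N) size_take size_map size_enum_ord ltn_ord big_mkord.
rewrite /offset (big_ord_widen d (fun i => nth 0%N (take j [seq part l j | j <- enum 'I_d]) i)).
  by apply: eq_bigr => i ij; rewrite nth_take// nth_part.
exact: ltnW.
Qed.

Lemma tlam_eq l j (b : nat) (a : 'I_n) : (b < part l j)%N ->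
  a = (offset l j + b)%N :> nat -> tlam l a = j.
Proof.
move=> bj aE; rewrite ffunE (tnth_nth j) /= /tlam_seq nth_flatten shape_tlam aE.
rewrite -sumn_take_part -[(_ + b)%N]/(flatten_index [seq part l j | j <- enum 'I_d] j b).
have bj' : (b < nth 0 [seq part l j | j <- enum 'I_d] j)%N by rewrite nth_part.
rewrite flatten_indexKl// flatten_indexKr// (nth_map j) ?size_enum_ord// nth_ord_enum.
by rewrite nth_nseq bj.
Qed.

Lemma tlam_block l (a : 'I_n) :
  (offset l (tlam l a) <= a < offset l (tlam l a) + part l (tlam l a))%N.
Proof.
pose sh := [seq part l j | j <- enum 'I_d].
have an : (a < sumn sh)%N.
  rewrite sumnE big_map big_enum /= (_ : (\sum_i part l i)%N = n)//.
  exact/eqP/(valP l).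
have := reshape_indexP an; rewrite {2}/sh size_map size_enum_ord => jd.
have := reshape_offsetP an; have := reshape_indexK sh a.
set b := reshape_offset sh a; rewrite /flatten_index.
rewrite -[reshape_index sh a]/(nat_of_ord (Ordinal jd)).
rewrite sumn_take_part nth_part => aE bj.
rewrite (tlam_eq bj (esym aE)); lia.
Qed.

Lemma offsetS_le l j j' : (j < j')%N -> (offset l j + part l j <= offset l j')%N.
Proof.
move=> jj'; rewrite /offset addnC [X in (_ <= X)%N](bigD1 j)//= leq_add2l.
rewrite [X in (X <= _)%N]big_mkcond [X in (_ <= X)%N]big_mkcond /=.
apply: leq_sum => i _; case: (ltnP i j) => // ij.
by rewrite (ltn_trans ij jj') -val_eqE /= ltn_eqF.
Qed.

Lemma tlam_sorted l : inversions (tlam l) = 0%N.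
Proof.
apply/eqP; rewrite sum_nat_eq0; apply/forallP => -[i j] /=; apply/implyP => ij.
rewrite eqb0 -leqNgt leqNgt; apply/negP => h.
have := offsetS_le l h; have /andP[_] := tlam_block l j; have /andP[] := tlam_block l i.
lia.
Qed.

Lemma JsetP l t : reflect (forall j, #|[set a | t a == j]| = part l j) (t \in Jset l).
Proof. by rewrite inE; apply: (iffP forallP) => h j; apply/eqP. Qed.

Lemma tlam_Jset l : tlam l \in Jset l.
Proof.
apply/JsetP => j; rewrite -sum1_card.
under eq_bigl do rewrite inE ffunE.
rewrite -(big_tuple _ _ _ (fun x => x == j) (fun=> 1%N)) /= sum1_count /tlam_seq.
rewrite count_flatten sumnE big_map big_map big_enum /= (bigD1 j)//= count_nseq /= eqxx mul1n.
by rewrite big1 ?addn0// => i ij; rewrite count_nseq /= (negbTE ij).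
Qed.

Lemma pact_Jset l t w : (pact w t \in Jset l) = (t \in Jset l).
Proof.
rewrite !inE; apply: eq_forallb => j; congr (_ == _).
rewrite -!sum1_card (reindex_inj (@perm_inj _ w)) /=.
by apply: eq_bigl => a; rewrite !inE ffunE permK.
Qed.

Lemma sorted_Jset_eq l t t' : t \in Jset l -> t' \in Jset l ->
  inversions t = 0%N -> inversions t' = 0%N -> t = t'.
Proof.
move=> /JsetP tJ /JsetP tJ' t0 t0'.
pose s u := [seq u a | a : 'I_n] : seq 'I_d.
have srt u : inversions u = 0%N -> sorted (fun x y : 'I_d => (x <= y)%N) (s u).
  move=> u0; rewrite /s; have := iota_sorted 0 n; rewrite -val_enum_ord /= !sorted_map.
  by apply: sub_sorted => i j /=; exact: inversions0_mono.
have E : s t = s t'.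
  apply: (sorted_eq (leT := fun x y : 'I_d => (x <= y)%N)); rewrite ?srt//.
  - by move=> x y z; exact: leq_trans.
  - by move=> x y /anti_leq /val_inj.
  apply/allP => j _ /=; have cnt u : count_mem j (s u) = #|[set a | u a == j]|.
    rewrite count_map -sum1_card -sum1_count big_enum_cond /=.
    by apply: eq_bigl => a; rewrite inE.
  by rewrite !cnt tJ tJ'.
by apply/ffunP => a; move/eq_in_map: E => /(_ a); apply; rewrite mem_enum.
Qed.

Lemma Jset_sorted l t : t \in Jset l -> inversions t = 0%N -> t = tlam l.
Proof.
by move=> tJ t0; apply: (sorted_Jset_eq tJ (tlam_Jset l)) => //; exact: tlam_sorted.
Qed.

Lemma Jset_inj l l' t : t \in Jset l -> t \in Jset l' -> l = l'.
Proof.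
move=> /JsetP h /JsetP h'; apply/val_inj/ffunP => j; apply/val_inj.
by have := h j; rewrite h'.
Qed.

Lemma Jset_exists t : exists l, t \in Jset l.
Proof.
have lt j : (#|[set a | t a == j]| < n.+1)%N.
  by rewrite ltnS -[X in (_ <= X)%N](card_ord n) max_card.
pose f : {ffun 'I_d -> 'I_n.+1} := [ffun j => Ordinal (lt j)].
have fP : (\sum_j f j == n :> nat)%N.
  rewrite -[X in _ == X](card_ord n) -sum1_card (partition_big t xpredT)//=.
  apply/eqP/eq_bigr => j _; rewrite ffunE /= -sum1_card.
  by apply: eq_bigl => a; rewrite inE.
exists (exist _ f fP); apply/JsetP => j.
by rewrite /part /= ffunE.
Qed.

Lemma slen_le m (w : 'S_m) p : wperm p = w -> (slen w <= size p)%N.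
Proof.
rewrite /slen => pw; case: ex_minnP => k _; apply; apply/asboolP.
by exists p.
Qed.

Lemma slen_word m (w : 'S_m) : exists p, size p = slen w /\ wperm p = w.
Proof. by rewrite /slen; case: ex_minnP => k /asboolP. Qed.

Lemma slenV m (w : 'S_m) : slen (w^-1)%g = slen w.
Proof.
suff le u : (slen (u^-1)%g <= slen (u : 'S_m))%N.
  by apply/eqP; rewrite eqn_leq le -{1}[w]invgK le.
have [p [sp pu]] := slen_word u; rewrite -sp -(size_rev p).
by apply: slen_le; rewrite wperm_rev pu.
Qed.

Lemma inversions_le_slen l t w : pact w t = tlam l -> (inversions t <= slen w)%N.
Proof.
move=> wt; have [p [<- pw]] := slen_word w; rewrite -(size_rev p).
by apply: inversions_le_size; rewrite revK pw wt tlam_sorted.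
Qed.

(** Sorting by descents produces a permutation of length at most [inversions t], and no permutation
    carrying t to t^lambda can be shorter. *)
Lemma pi_P l t : t \in Jset l ->
  pact (pi_ l t) t = tlam l /\ slen (pi_ l t) = inversions t.
Proof.
move=> tJ; have [p dp] := down_exists t.
pose w := wperm (rev p).
have wt : pact w t = tlam l.
  by apply: Jset_sorted; [rewrite pact_Jset | exact: down_sorted].
have sw : (slen w <= inversions t)%N.
  by rewrite -(down_size dp) -(size_rev p) slen_le.
(* The default value of [arg min] is irrelevant, as the minimum exists. *)
have -> : pi_ l t = [arg min_(v < w | pact v t == tlam l) slen v].
  rewrite /pi_ /arg_min /extremum; case: pickP => // h.
  have [v vt vmin] := @arg_minnP _ w (fun v : 'S_n => pact v t == tlam l) (@slen n) (introT eqP wt).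
  have := h v; rewrite /= vt /= => /negP[]; apply/forallP => u.
  by apply/implyP => /vmin.
case: arg_minnP => [|v /eqP vt vmin]; first exact/eqP.
split=> //; apply/eqP; rewrite eqn_leq (inversions_le_slen vt) andbT.
by apply: leq_trans sw; apply: vmin; rewrite wt.
Qed.

Lemma reduced_pi_down l t p : t \in Jset l -> reduced_word (pi_ l t) p ->
  down t (rev p).
Proof.
move=> tJ [pw sp]; have [pt sl] := pi_P tJ.
by apply: down_minimal; rewrite ?revK ?pw ?pt ?tlam_sorted// size_rev sp.
Qed.

Lemma reduced_piV_down l t p : t \in Jset l -> reduced_word (pi_ l t)^-1%g p ->
  down t p.
Proof.
move=> tJ [pw sp]; have [pt sl] := pi_P tJ.
apply: down_minimal; last by rewrite sp slenV.
by rewrite wperm_rev pw invgK pt tlam_sorted.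
Qed.

(** By confluence the permutation does not depend on the sorting word, so the choice made by
    [arg min] is the only possible one. *)
Lemma pi_down l t p : t \in Jset l -> down t p -> wperm (rev p) = pi_ l t.
Proof.
move=> tJ dp; have [q [sq qw]] := slen_word (pi_ l t).
have dq : down t (rev q) by apply: (reduced_pi_down tJ).
by rewrite wperm_rev (wperm_down dp dq) wperm_rev qw invgK.
Qed.
End MinimalPermutations.

(** * Colour idempotents *)

Section ColourIdempotents.
Variables (e d n : nat) (L : 'Z_e * 'I_d -> nat) (H : pzRingType).
Local Notation K := ('Z_e * 'I_d)%type.
Local Notation word := {ffun 'I_n -> 'I_d}.
Variables (e_ : {ffun 'I_n -> K} -> H) (y : 'I_n -> H) (psi : 'I_n.-1 -> H).
Hypothesis fam : quiver_family (@edge_K e d) L e_ y psi.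
Implicit Types (t : word) (k : {ffun 'I_n -> K}) (a b c : 'I_n.-1) (p : seq 'I_n.-1).

Definition colour k : word := [ffun a => (k a).2].
Definition colour_idem t : H := \sum_(k | colour k == t) e_ k.
Local Notation et := colour_idem.

Lemma colour_pact (w : 'S_n) k : colour (pact w k) = pact w (colour k).
Proof. by apply/ffunP => a; rewrite !ffunE. Qed.

Lemma colour_idem_e t k : et t * e_ k = if colour k == t then e_ k else 0.
Proof.
rewrite mulr_suml; case: ifPn => kt.
  rewrite (bigD1 k)//= (Qe_mul fam) eqxx big1 ?addr0// => k' /andP[_ /negbTE kk'].
  by rewrite (Qe_mul fam) kk'.
rewrite big1// => k' k't; rewrite (Qe_mul fam).
by case: eqP => // kk'; rewrite -kk' k't in kt.
Qed.

Lemma eq_colour_idem t x x' : (forall k, colour k = t -> x * e_ k = x' * e_ k) ->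
  x * et t = x' * et t.
Proof. by move=> h; rewrite !mulr_sumr; apply: eq_bigr => k /eqP /h. Qed.

Lemma colour_idem_idem t : et t * et t = et t.
Proof.
rewrite -[RHS]mul1r; apply: eq_colour_idem => k kt.
by rewrite colour_idem_e kt eqxx mul1r.
Qed.

Lemma colour_idem_y t (c : 'I_n) : y c * et t = et t * y c.
Proof. by rewrite mulr_suml mulr_sumr; apply: eq_bigr => k _; rewrite (Qy_e fam). Qed.

Lemma colour_idem_psi t a : psi a * et t = et (pact (sadj a) t) * psi a.
Proof.
rewrite mulr_suml mulr_sumr [RHS](reindex_inj (inv_inj (@pact_sadjK _ n a))) /=.
rewrite [LHS]big_mkcond [RHS]big_mkcond; apply: eq_bigr => k _.
by rewrite (Qpsi_e fam) colour_pact (inj_eq (inv_inj (@pact_sadjK _ n a))).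
Qed.

(** Vertices of different colours lie in different components of the quiver, hence are unlinked. *)
Lemma psi_sq_colour t a : t (lpos a) != t (rpos a) -> psi a * psi a * et t = et t.
Proof.
move=> ne; rewrite -[RHS]mul1r; apply: eq_colour_idem => k kt; rewrite mul1r -expr2.
move: ne; rewrite -kt !ffunE => ne; apply: (Qpsi_sq_unlinked fam).
have ne' : ((k (rpos a)).2 == (k (lpos a)).2) = false by rewrite eq_sym; exact/negbTE.
by rewrite /unlinked /edge_K ne' (negbTE ne) !andbF /= andbT; apply: contraNneq ne => ->.
Qed.

Lemma psi_y_colour t a (c : 'I_n) : t (lpos a) != t (rpos a) ->
  psi a * y c * et t = y (sadj a c) * psi a * et t.
Proof.
move=> ne; apply: eq_colour_idem => k kt; apply: (Qpsi_y_neq fam).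
by apply: contraNneq ne; rewrite -kt !ffunE => ->.
Qed.

(** An error term requires k_{a+2} = k_a joined by an edge to k_{a+1}; edges preserve the colour, so
    all three colours would agree. *)
Lemma psi_braid_colour t a b : b = a.+1 :> nat ->
  ~~ ((t (lpos a) == t (rpos a)) && (t (lpos a) == t (rpos b))) ->
  psi b * psi a * psi b * et t = psi a * psi b * psi a * et t.
Proof.
move=> ba ne; apply: eq_colour_idem => k kt; apply: (Qpsi_braid fam) => //.
apply: contra ne => /andP[/eqP kk /orP kE]; rewrite -kt !ffunE kk eqxx andbT.
by case: kE => /andP[_ /eqP ->].
Qed.

Definition psi_word p : H := \prod_(a <- p) psi a.

Lemma psi_word_rev a p : psi_word (rev (a :: p)) = psi_word (rev p) * psi a.
Proof. by rewrite /psi_word rev_cons -cats1 big_cat big_seq1. Qed.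

Lemma psi_word_cons a p : psi_word (a :: p) = psi a * psi_word p.
Proof. exact: big_cons. Qed.

Lemma psi_word_e p k :
  psi_word (rev p) * e_ k = e_ (pact (wperm (rev p)) k) * psi_word (rev p).
Proof.
elim: p k => [|a p IH] k; first by rewrite /psi_word big_nil pact1 mul1r mulr1.
by rewrite psi_word_rev -mulrA (Qpsi_e fam) mulrA IH pact_wperm_cons -mulrA.
Qed.

Lemma psi_word_idem p t :
  psi_word (rev p) * et t = et (pact (wperm (rev p)) t) * psi_word (rev p).
Proof.
elim: p t => [|a p IH] t; first by rewrite /psi_word big_nil pact1 mul1r mulr1.
by rewrite psi_word_rev -mulrA colour_idem_psi mulrA IH pact_wperm_cons -mulrA.
Qed.

Lemma psi_word_inv t p : down t p -> psi_word p * (psi_word (rev p) * et t) = et t.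
Proof.
elim: p t => [|a p IH] t; first by rewrite /psi_word !big_nil !mul1r.
move=> /= /andP[ta dp]; rewrite psi_word_rev psi_word_cons -!mulrA colour_idem_psi.
rewrite [psi_word (rev p) * _]mulrA [psi_word p * _]mulrA IH// -colour_idem_psi mulrA.
by rewrite psi_sq_colour// -val_eqE gtn_eqF.
Qed.

Lemma psi_word_y t p (c : 'I_n) : down t p ->
  y (wperm (rev p) c) * (psi_word (rev p) * et t) = psi_word (rev p) * et t * y c.
Proof.
elim: p t c => [|a p IH] t c.
  by rewrite /psi_word big_nil !mul1r perm1 colour_idem_y.
move=> /= /andP[ta dp]; have ne : t (lpos a) != t (rpos a) by rewrite -val_eqE gtn_eqF.
rewrite psi_word_rev wperm_rev_cons permM -[in LHS]mulrA colour_idem_psi.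
rewrite [psi_word _ * (_ * _)]mulrA mulrA IH// -!mulrA; congr (_ * _).
rewrite -colour_idem_y !mulrA -colour_idem_y -[LHS]mulrA -colour_idem_psi mulrA.
by rewrite -psi_y_colour.
Qed.

Lemma psi_word_unique t p p' : down t p -> down t p' ->
  psi_word (rev p) * et t = psi_word (rev p') * et t.
Proof.
apply: (down_confluent (f := fun t p => psi_word (rev p) * et t)) => {t p p'}.
- by move=> t a p p'; rewrite !psi_word_rev -!mulrA colour_idem_psi !mulrA => ->.
- move=> t a b p ab; rewrite !psi_word_rev -!mulrA; congr (_ * _).
  by rewrite !mulrA (Qpsi_far fam)// ab orbT.
- move=> t a b p ba tba; rewrite !psi_word_rev -!mulrA; congr (_ * _).
  rewrite !mulrA (psi_braid_colour ba)//.
  by rewrite negb_and orbC -val_eqE /= gtn_eqF.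
Qed.

(** Induction along the glide. A distant letter commutes with psi_a; an adjacent letter c is passed
    by psi_c psi_a psi_c e(t) = psi_a psi_c psi_a e(t), which has no error term because the letter
    passed has another colour than the pair. *)
Lemma psi_word_glide t a p b : glide t a p b -> down t p ->
  t (lpos a) = t (rpos a) ->
  psi b * (psi_word (rev p) * et t) = psi_word (rev p) * (psi a * et t).
Proof.
have fix_pair t' a' : t' (lpos a') = t' (rpos a') -> pact (sadj a') t' = t'.
  by move=> h; apply/ffunP => i; rewrite pact_sadjE /sadj; case: tpermP => [->|->|].
elim=> {t a p b} [t a _ ta|t a c p b ac _ IH|t a c p b adj tc _ IH] /=.
- by rewrite /psi_word big_nil !mul1r.
- move=> /andP[_ dp] ta; rewrite psi_word_rev -!mulrA colour_idem_psi.
  rewrite [psi_word _ * (_ * _)]mulrA mulrA IH//.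
    rewrite -!mulrA -colour_idem_psi; congr (_ * _).
    by rewrite !mulrA (Qpsi_far fam)// orbC.
  have /orP ac' := ac; rewrite !pact_sadjE /sadj !tpermD// -val_eqE /=; lia.
move=> /andP[_ /andP[_ dp]] ta; set t2 := pact _ _ in dp IH.
have h : psi a * psi c * et t = et t2 * (psi a * psi c).
  by rewrite -mulrA colour_idem_psi mulrA colour_idem_psi -!mulrA.
have t2c : t2 (lpos c) = t2 (rpos c) by exact: glide_adj_pair.
rewrite !psi_word_rev -!mulrA [psi a * (psi c * et t)]mulrA h.
rewrite [psi_word _ * (_ * _)]mulrA mulrA IH// -!mulrA -h; congr (_ * _); rewrite !mulrA.
case/orP: adj => /eqP adj; have ac := rpos_lpos (esym adj).
  apply: psi_braid_colour => //.
  by move: tc; rewrite -ac ta eqxx.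
apply/esym/psi_braid_colour => //.
by rewrite negb_and tc.
Qed.

(** Two words occur because the reduced words chosen for pi_t and for its inverse need not be the
    reverse of each other; uniqueness replaces [rev p] by [rev p'], which p' then cancels. *)
Lemma psi_word_conj t p p' (x z : H) k : down t p -> down t p' -> colour k = t ->
  x * (psi_word (rev p) * et t) = psi_word (rev p) * et t * z ->
  psi_word p' * x * psi_word (rev p) * e_ k = et t * (z * e_ k).
Proof.
move=> dp dp' kt xz.
have ek : psi_word (rev p) * e_ k = psi_word (rev p) * et t * e_ k.
  by rewrite -mulrA colour_idem_e kt eqxx.
rewrite -mulrA ek -[psi_word p' * x * _]mulrA [x * _]mulrA xz.
rewrite (psi_word_unique dp dp') -!mulrA.
by rewrite [psi_word (rev p') * _]mulrA [psi_word p' * _]mulrA psi_word_inv.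
Qed.
End ColourIdempotents.

(** * Tensor products and corner embeddings *)

Section TensorFactors.
Variables (F : fieldType) (J : finType) (A : J -> pzAlgType F).
Implicit Types (x : pure A) (j : J).

Lemma pset_in x j (a : A j) : pset x a j = a.
Proof. exact: eqtype.dfwith_in. Qed.

Lemma pset_out x j (a : A j) i : j != i -> pset x a i = x i.
Proof. exact: eqtype.dfwith_out. Qed.

Lemma pureP x x' : (forall j, x j = x' j) -> x = x'.
Proof. exact: functional_extensionality_dep. Qed.

Lemma pset_id x j : pset x (x j) = x.
Proof. by apply: pureP => i; have [<-|ji] := eqVneq j i; rewrite ?pset_in// pset_out. Qed.

Lemma pset_pset x j (a a' : A j) : pset (pset x a') a = pset x a.
Proof.
by apply: pureP => i; have [<-|ji] := eqVneq j i; rewrite ?pset_in// !pset_out.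
Qed.

Lemma tens_eq0 x j : x j = 0 -> tens x = 0.
Proof.
move=> xj; rewrite -(pset_id x j) xj.
have := tensZ x 0 (0 : A j); rewrite mulr0 => ->.
by rewrite -[0%:S]/(@scal F (tensor A) 0) raddf0 mul0r.
Qed.

Lemma tens_inD j (a a' : A j) : tens_in (a + a') = tens_in a + tens_in a'.
Proof. exact: tensD. Qed.

Lemma tens_inZ j (c : F) (a : A j) : tens_in (c%:S * a) = c%:S * tens_in a.
Proof. exact: tensZ. Qed.

Lemma tens_in0 j : tens_in (0 : A j) = 0.
Proof. by apply: (@tens_eq0 _ j); rewrite pset_in. Qed.

Lemma tens_in_tens j (a : A j) x : tens_in a * tens x = tens (pset x (a * x j)).
Proof.
rewrite /tens_in tensM; congr tens; apply: pureP => i.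
have [<-|ji] := eqVneq j i; first by rewrite !pset_in.
by rewrite !pset_out// mul1r.
Qed.

Lemma tens_inM j (a a' : A j) : tens_in (a * a') = tens_in a * tens_in a'.
Proof. by rewrite [RHS]tens_in_tens pset_pset pset_in. Qed.

Lemma tens_in1 j : tens_in (1 : A j) = 1.
Proof. by rewrite -tens1 /tens_in (pset_id (fun=> 1)). Qed.

Lemma tens_in_sum j (I : Type) (r : seq I) (P : pred I) (f : I -> A j) :
  tens_in (\sum_(i <- r | P i) f i) = \sum_(i <- r | P i) tens_in (f i).
Proof. by apply: (big_morph (@tens_in _ _ _ j)); [exact: tens_inD | exact: tens_in0]. Qed.

Lemma tens_prod x : tens x = \prod_j tens_in (x j).
Proof.
suff h s : uniq s ->
    \prod_(j <- s) tens_in (x j) = tens (fun j => if j \in s then x j else 1).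
  by rewrite h ?index_enum_uniq//; congr tens; apply: pureP => j; rewrite mem_index_enum.
elim: s => [_|j s IH] /=; first by rewrite big_nil -tens1.
move=> /andP[js us]; rewrite big_cons IH// tens_in_tens; congr tens; apply: pureP => i.
rewrite inE; have [<-|ji] := eqVneq j i; first by rewrite pset_in (negbTE js) mulr1 ?eqxx.
by rewrite pset_out// ?(eq_sym i) ?(negbTE ji).
Qed.

(** Multilinearity in all factors at once, meant for expanding 1 into tensors of idempotents. The
    index sets depend on j, whence [fprod] and a detour through tagged families to reach the
    distributivity of products over sums. *)
Lemma tens_sum (K : J -> finType) (f : forall j, K j -> A j) :
  tens (fun j => \sum_(c : K j) f j c) = \sum_(g : fprod K) tens (fun j => f j (g j)).
Proof.
rewrite tens_prod; transitivity (\prod_j \sum_(c : K j) tens_in (f j c)).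
  by apply: eq_bigr => j _; rewrite tens_in_sum.
under [in RHS]eq_bigr do rewrite tens_prod.
pose P j : {ffun K j -> tensor A} := [ffun c => tens_in (f j c)].
transitivity (\prod_j \sum_(c : K j) P j c).
  by apply: eq_bigr => j _; apply: eq_bigr => c _; rewrite ffunE.
transitivity (\sum_(g : fprod K) \prod_j P j (g j)); last first.
  by apply: eq_bigr => g _; apply: eq_bigr => j _; rewrite ffunE.
rewrite (@big_fprod _ 0 1 *%R +%R _ _ P).
under eq_bigr do rewrite (big_tag P).
exact: (bigA_distr_big_dep (fun i => tagged_with K i) (fun i u => untag 0 (P i) u)).
Qed.
End TensorFactors.

Section Blocks.
Variables (e d n : nat) (l : dcomp d n).
Local Notation K := ('Z_e * 'I_d)%type.
Local Notation ffK := {ffun 'I_n -> K}.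

Fact block_pos_subproof j (b : 'I_(part l j)) : (offset l j + b < n)%N.
Proof.
apply: (@leq_trans (offset l j + part l j)%N); first by rewrite ltn_add2l.
rewrite -[X in (_ <= X)%N](eqP (valP l)) (bigD1 j)//= addnC leq_add2l /offset.
rewrite [X in (X <= _)%N]big_mkcond [X in (_ <= X)%N]big_mkcond /=.
by apply: leq_sum => i _; rewrite -val_eqE /=; case: ltngtP.
Qed.
Definition block_pos j (b : 'I_(part l j)) : 'I_n := Ordinal (block_pos_subproof b).

Fact block_index_subproof (a : 'I_n) : (a - offset l (tlam l a) < part l (tlam l a))%N.
Proof. by have := tlam_block l a; lia. Qed.
Definition block_index (a : 'I_n) : 'I_(part l (tlam l a)) :=
  Ordinal (block_index_subproof a).

Lemma tlam_block_pos j (b : 'I_(part l j)) : tlam l (block_pos b) = j.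
Proof. exact: (tlam_eq (ltn_ord b)). Qed.

Definition block_word (k : ffK) j : {ffun 'I_(part l j) -> 'Z_e} :=
  [ffun b => (k (block_pos b)).1].

Lemma block_wordP (k : ffK) j (b : 'I_(part l j)) (a : 'I_n) : colour k = tlam l ->
  a = (offset l j + b)%N :> nat -> k a = (block_word k j b, j).
Proof.
move=> kl ab; have -> : a = block_pos b by exact: val_inj.
rewrite ffunE; have := congr1 (fun f : {ffun _} => f (block_pos b)) kl.
by rewrite ffunE tlam_block_pos; case: (k _) => ? ? /= ->.
Qed.

Definition glue_words (g : fprod (fun j => {ffun 'I_(part l j) -> 'Z_e})) : ffK :=
  [ffun a => (g (tlam l a) (block_index a), tlam l a)].

Lemma glue_wordsP g j (b : 'I_(part l j)) (a : 'I_n) :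
  a = (offset l j + b)%N :> nat -> glue_words g a = (g j b, j).
Proof.
move=> ab; have aj := tlam_eq (ltn_ord b) ab.
rewrite ffunE; congr (_, _); last exact: aj.
have : block_index a = b :> nat by rewrite /= aj ab addKn.
by move: (block_index a); rewrite aj => b' /val_inj ->.
Qed.

End Blocks.

Section CornerEmbedding.
Variables (F : fieldType) (e d n : nat) (q : F) (L : 'Z_e -> nat) (l : dcomp d n).
Local Notation K := ('Z_e * 'I_d)%type.
Local Notation ffK := {ffun 'I_n -> K}.
Variables (H : pzAlgType F) (e_ : ffK -> H) (y : 'I_n -> H) (psi : 'I_n.-1 -> H).
Hypothesis fam : quiver_family (@edge_K e d) (fun k => L k.1) e_ y psi.
Variables (A : 'I_d -> pzAlgType F).
Variables (eA : forall j, {ffun 'I_(part l j) -> 'Z_e} -> A j)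
  (yA : forall j, 'I_(part l j) -> A j) (psiA : forall j, 'I_(part l j).-1 -> A j).
Arguments eA {j}.
Arguments yA {j}.
Arguments psiA {j}.
Hypothesis famA : forall j, quiver_family (@edge_e e) L (@eA j) (@yA j) (@psiA j).
Variable iota : tensor A -> H.
Local Notation eps := (colour_idem e_ (tlam l)).
Hypotheses (iotaD : {morph iota : u v / u + v}) (iotaM : {morph iota : u v / u * v})
  (iotaZ : forall (c : F) v, iota (c%:S * v) = c%:S * iota v).
Hypothesis iota_y : forall (j : 'I_d) (b : 'I_(part l j)) (a : 'I_n),
  a = (offset l j + b)%N :> nat -> iota (tens_in (yA b)) = y a * eps.
Hypothesis iota_psi : forall (j : 'I_d) (b : 'I_(part l j).-1) (a : 'I_n.-1),
  a = (offset l j + b)%N :> nat -> iota (tens_in (psiA b)) = psi a * eps.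
Hypothesis iota_e : forall (k_ : forall j : 'I_d, {ffun 'I_(part l j) -> 'Z_e}) (k : ffK),
  (forall j (b : 'I_(part l j)) (a : 'I_n),
     a = (offset l j + b)%N :> nat -> k a = (k_ j b, j)) ->
  iota (tens (fun j => eA (k_ j))) = e_ k.

Lemma iota0 : iota 0 = 0.
Proof. by apply: (addrI (iota 0)); rewrite -iotaD !addr0. Qed.

(** In each factor 1 is the sum of the idempotents. Gluing is a bijection from the families of words
    k^j onto the words k of colour t^lambda, so the expanded tensor is sent to the sum of these
    e(k). *)
Lemma iota1 : iota 1 = eps.
Proof.
rewrite -tens1 (_ : (fun=> 1) = (fun j => \sum_k @eA j k)); last first.
  by apply: pureP => j; rewrite (sum_Qe (famA j)).
rewrite tens_sum (big_morph iota iotaD iota0).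
rewrite /colour_idem (reindex (@glue_words e d n l)) /=.
  have col (g : fprod (fun j => {ffun 'I_(part l j) -> 'Z_e})) :
      colour (glue_words g) == tlam l.
    by apply/eqP/ffunP => a; rewrite ffunE [X in X.2]ffunE.
  under [RHS]eq_bigl do rewrite col.
  by apply: eq_bigr => g _; apply: iota_e => j b a; exact: glue_wordsP.
exists (fun k => [fprod j => block_word l k j]) => [g _|k /eqP kl].
  apply/fprodP => j; rewrite fprodE; apply/ffunP => b.
  by rewrite ffunE (glue_wordsP g (b := b) (a := block_pos b)).
apply/ffunP => a; rewrite [RHS](block_wordP (b := block_index l a) kl).
  by rewrite ffunE fprodE.
by have := tlam_block l a; rewrite /=; lia.
Qed.

Definition iota_in j (x : A j) : H := iota (tens_in x).

Lemma iota_inM j (x x' : A j) : iota_in (x * x') = iota_in x * iota_in x'.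
Proof. by rewrite /iota_in tens_inM iotaM. Qed.

Lemma iota_inB j (x x' : A j) : iota_in (x - x') = iota_in x - iota_in x'.
Proof.
apply: (addIr (iota_in x')); rewrite subrK /iota_in -iotaD -tens_inD.
by rewrite subrK.
Qed.

Lemma iota_in1 j : iota_in (1 : A j) = eps.
Proof. by rewrite /iota_in tens_in1 iota1. Qed.

(** e(k) is itself the image of a pure tensor, whose j-th factor absorbs the idempotent. *)
Lemma iota_in_e j (k : ffK) : colour k = tlam l ->
  iota_in (eA (block_word l k j)) * e_ k = e_ k.
Proof.
move=> kl; have ek : iota (tens (fun j => eA (block_word l k j))) = e_ k.
  by apply: iota_e => j' b a; exact: block_wordP.
rewrite -{1}ek -iotaM tens_in_tens (Qe_mul (famA j)) eqxx.
by rewrite -ek; congr iota; congr tens; exact: (pset_id (fun j => eA (block_word l k j))).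
Qed.

Lemma iota_in_scal j c : iota_in (c%:S : A j) = c%:S * eps.
Proof. by rewrite /iota_in -[c%:S in LHS]mulr1 tens_inZ iotaZ tens_in1 iota1. Qed.

Lemma iota_in_y j (b : 'I_(part l j)) (a : 'I_n) :
  a = (offset l j + b)%N :> nat -> iota_in (yA b) = y a * eps.
Proof. exact: iota_y. Qed.

Lemma iota_in_psi j (b : 'I_(part l j).-1) (a : 'I_n.-1) :
  a = (offset l j + b)%N :> nat -> iota_in (psiA b) = psi a * eps.
Proof. exact: iota_psi. Qed.

End CornerEmbedding.

(* The composite phi of the embedding of one tensor factor B with the corner
   embedding. *)
Section CornerFactor.
Variables (F : fieldType) (e d n : nat) (q : F) (L : 'Z_e -> nat) (l : dcomp d n).
Local Notation K := ('Z_e * 'I_d)%type.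
Local Notation ffK := {ffun 'I_n -> K}.
Variables (H : pzAlgType F) (e_ : ffK -> H) (y : 'I_n -> H) (psi : 'I_n.-1 -> H).
Hypothesis fam : quiver_family (@edge_K e d) (fun k => L k.1) e_ y psi.
Variables (j : 'I_d) (B : pzAlgType F) (eB : {ffun 'I_(part l j) -> 'Z_e} -> B)
  (yB : 'I_(part l j) -> B) (psiB : 'I_(part l j).-1 -> B).
Hypothesis famB : quiver_family (@edge_e e) L eB yB psiB.
Local Notation eps := (colour_idem e_ (tlam l)).
Variable phi : B -> H.
Hypotheses (phiM : {morph phi : x x' / x * x'}) (phiB : {morph phi : x x' / x - x'})
  (phi1 : phi 1 = eps) (phi_scal : forall c : F, phi c%:S = c%:S * eps).
Hypothesis phi_e : forall k, colour k = tlam l -> phi (eB (block_word l k j)) * e_ k = e_ k.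
Hypothesis phi_y : forall (b : 'I_(part l j)) (a : 'I_n),
  a = (offset l j + b)%N :> nat -> phi (yB b) = y a * eps.
Hypothesis phi_psi : forall (b : 'I_(part l j).-1) (a : 'I_n.-1),
  a = (offset l j + b)%N :> nat -> phi (psiB b) = psi a * eps.

Lemma corner_sum (f : {ffun 'I_(part l j) -> 'Z_e} -> B) (k : ffK) :
  colour k = tlam l ->
  phi (\sum_k' f k' * eB k') * e_ k = phi (f (block_word l k j)) * e_ k.
Proof.
move=> kl; have ek := phi_e kl; set x := \sum_k' _.
have xe : x * eB (block_word l k j) = f (block_word l k j) * eB (block_word l k j).
  rewrite /x mulr_suml (bigD1 (block_word l k j))//= big1 => [|k' kk'].
    by rewrite addr0 -mulrA (Qe_mul famB) eqxx.
  by rewrite -mulrA (Qe_mul famB) (negbTE kk') mulr0.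
by rewrite -ek !mulrA -(phiM x) xe (phiM (f _)) -!mulrA ek.
Qed.

(** X represents the image of x in the corner cut out by eps. Commutation with eps is what makes the
    relation multiplicative and stable under inversion, X being inverted in the whole of H. *)
Definition corner_rel (x : B) (X : H) : Prop :=
  phi x = X * eps /\ X * eps = eps * X.

Lemma corner_rel1 : corner_rel (1 : B) 1.
Proof. by split; rewrite ?phi1 ?mul1r ?mulr1. Qed.

Lemma corner_relB (x : B) (X : H) (x' : B) (X' : H) :
  corner_rel x X -> corner_rel x' X' -> corner_rel (x - x') (X - X').
Proof.
by move=> [h c] [h' c']; split; rewrite ?phiB mulrBl ?h ?h' ?mulrBr ?c ?c'.
Qed.

Lemma corner_relM (x : B) (X : H) (x' : B) (X' : H) :
  corner_rel x X -> corner_rel x' X' -> corner_rel (x * x') (X * X').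
Proof.
move=> [h c] [h' c']; split; last by rewrite -mulrA c' mulrA c mulrA.
rewrite phiM h h' -!mulrA [eps * _]mulrA -c' -mulrA.
by rewrite (colour_idem_idem fam).
Qed.

Lemma corner_relS c : corner_rel (c%:S : B) c%:S.
Proof.
by split; [exact: phi_scal | exact: scalC].
Qed.

(** phi is not unital: phi (rinv x) inverts X eps in the corner only. Cancelling X on the left of
    phi (x * rinv x) = eps gives the claim. *)
Lemma corner_relV (x : B) X : invertible x -> invertible X ->
  corner_rel x X -> corner_rel (rinv x) (rinv X).
Proof.
move=> ix iX [h c]; have cV : rinv X * eps = eps * rinv X by exact: comm_rinv.
split=> //; rewrite -phi1 -(rinvP ix).1 phiM h.
rewrite -[in RHS]mulrA mulrA (rinvP iX).2 mul1r -phi1 -phiM.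
by rewrite mul1r.
Qed.

Lemma corner_rel_y (b : 'I_(part l j)) (a : 'I_n) :
  a = (offset l j + b)%N :> nat -> corner_rel (yB b) (y a).
Proof. by move=> ab; split; [exact: phi_y | rewrite (colour_idem_y fam)]. Qed.

Lemma corner_rel_psi (b : 'I_(part l j).-1) (a : 'I_n.-1) :
  a = (offset l j + b)%N :> nat -> corner_rel (psiB b) (psi a).
Proof.
move=> ab; split; first exact: phi_psi.
rewrite (colour_idem_psi fam); congr (colour_idem _ _ * _).
(* Both positions belong to block j, so s_a fixes t^lambda. *)
have tl : tlam l (lpos a) = tlam l (rpos a).
  have b1 : (b.+1 < part l j)%N by rewrite -ltn_predRL.
  rewrite (@tlam_eq _ _ l j b (lpos a) (ltnW b1))//.
  by rewrite (@tlam_eq _ _ l j b.+1 (rpos a) b1)//= ab addnS.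
by apply/ffunP => c; rewrite pact_sadjE /sadj; case: tpermP => [->|->|].
Qed.

Hypotheses (e_gt1 : (1 < e)%N) (q_prim : e.-primitive_root q).

Lemma corner_rel_series (b b' : 'I_(part l j)) (a a' : 'I_n) (i i' : 'Z_e) :
  a = (offset l j + b)%N :> nat -> a' = (offset l j + b')%N :> nat ->
  corner_rel (Qser q i i' (yB b) (yB b')) (Qser q i i' (y a) (y a')) /\
  corner_rel (Pser q i i' (yB b) (yB b')) (Pser q i i' (y a) (y a')).
Proof.
move=> ab ab'; have [h h'] := (corner_rel_y ab, corner_rel_y ab').
have [c c'] := (Qyy famB b b', Qyy fam a a').
have [nb nb'] := (Qy_nilpotent famB b, Qy_nilpotent famB b').
have [na na'] := (Qy_nilpotent fam a, Qy_nilpotent fam a').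
split.
  exact: (Qser_transport corner_rel1 corner_relB corner_relM corner_relS corner_relV
  e_gt1 q_prim c c' nb nb' na na' h h').
exact: (Pser_transport corner_rel1 corner_relB corner_relM corner_relS corner_relV
  e_gt1 q_prim c c' nb nb' na na' h h').
Qed.

Lemma corner_rel_e (x : B) X (k : ffK) : colour k = tlam l -> corner_rel x X ->
  phi x * e_ k = X * e_ k.
Proof. by move=> kl [-> _]; rewrite -mulrA (colour_idem_e fam) kl eqxx. Qed.

Lemma corner_BK_g (b : 'I_(part l j).-1) (a : 'I_n.-1) (k : ffK) :
  colour k = tlam l -> a = (offset l j + b)%N :> nat ->
  phi (\sum_(k' : {ffun 'I_(part l j) -> 'Z_e})
     (psiB b * Qser q (k' (lpos b)) (k' (rpos b)) (yB (lpos b)) (yB (rpos b))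
      - Pser q (k' (lpos b)) (k' (rpos b)) (yB (lpos b)) (yB (rpos b))) * eB k') * e_ k
  = (psi a * Qser q (k (lpos a)).1 (k (rpos a)).1 (y (lpos a)) (y (rpos a))
     - Pser q (k (lpos a)).1 (k (rpos a)).1 (y (lpos a)) (y (rpos a))) * e_ k.
Proof.
move=> kl ab; have al : lpos a = (offset l j + lpos b)%N :> nat by [].
have ar : rpos a = (offset l j + rpos b)%N :> nat by rewrite /= addnS ab.
rewrite corner_sum// (block_wordP kl al) (block_wordP kl ar) /=.
apply: corner_rel_e => //; have [hQ hP] := corner_rel_series
  (block_word l k j (lpos b)) (block_word l k j (rpos b)) al ar.
by apply: corner_relB => //; apply: corner_relM => //; exact: corner_rel_psi.
Qed.

Lemma corner_BK_X (b : 'I_(part l j)) (a : 'I_n) (k : ffK) :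
  colour k = tlam l -> a = (offset l j + b)%N :> nat ->
  phi (\sum_(k' : {ffun 'I_(part l j) -> 'Z_e}) (q ^+ k' b)%:S * (1 - yB b) * eB k') * e_ k
  = (q ^+ (k a).1)%:S * (1 - y a) * e_ k.
Proof.
move=> kl ab; rewrite corner_sum// (block_wordP kl ab) /=.
apply: corner_rel_e => //; apply: corner_relM; first exact: corner_relS.
by apply: corner_relB; [exact: corner_rel1 | exact: corner_rel_y].
Qed.
End CornerFactor.

(** * The map Phi *)

Section Assembly.
Variables (F : fieldType) (e d n : nat) (q sq : F) (L : 'Z_e -> nat).
Local Notation K := ('Z_e * 'I_d)%type.
Local Notation ffK := {ffun 'I_n -> K}.
Local Notation word := {ffun 'I_n -> 'I_d}.
Variables (H : pzAlgType F) (e_ : ffK -> H) (y : 'I_n -> H) (psi : 'I_n.-1 -> H).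
Hypothesis fam : quiver_family (@edge_K e d) (fun k => L k.1) e_ y psi.
Hypotheses (e_gt1 : (1 < e)%N) (q_prim : e.-primitive_root q).
Local Notation et := (colour_idem e_).
Local Notation psi_word := (psi_word psi).

Definition BK_g (a : 'I_n.-1) (k : ffK) : H :=
  psi a * Qser q (k (lpos a)).1 (k (rpos a)).1 (y (lpos a)) (y (rpos a))
  - Pser q (k (lpos a)).1 (k (rpos a)).1 (y (lpos a)) (y (rpos a)).

(** Meant for U = psi_{pi_t} e(t), and also for U = e(t) with t_a = t_{a+1}, where it says that the
    image of g_a commutes with e(t). *)
Lemma BK_g_intertwine (U : H) (k k' : ffK) (a b : 'I_n.-1) :
  y (lpos b) * U = U * y (lpos a) -> y (rpos b) * U = U * y (rpos a) ->
  psi b * U = U * psi a -> k' (lpos b) = k (lpos a) -> k' (rpos b) = k (rpos a) ->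
  BK_g b k' * U = U * BK_g a k.
Proof.
move=> Ul Ur Up kl kr; rewrite /BK_g kl kr.
pose T (x z : H) := x * U = U * z.
have T1 : T 1 1 by rewrite /T mul1r mulr1.
have TB x z x' z' : T x z -> T x' z' -> T (x - x') (z - z').
  by rewrite /T mulrBl mulrBr => -> ->.
have TM x z x' z' : T x z -> T x' z' -> T (x * x') (z * z').
  by rewrite /T => h h'; rewrite -mulrA h' !mulrA h.
have TS c : T c%:S c%:S by exact: scalC.
have TV x z : invertible x -> invertible z -> T x z -> T (rinv x) (rinv z).
  move=> ix iz xz; rewrite /T -[LHS]mulr1 -(rinvP iz).1.
  by rewrite mulrA -[_ * U * z]mulrA -xz mulrA (rinvP ix).2 mul1r.
have [nl nr] := (Qy_nilpotent fam (lpos b), Qy_nilpotent fam (rpos b)).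
have [nl' nr'] := (Qy_nilpotent fam (lpos a), Qy_nilpotent fam (rpos a)).
have [c c'] := (Qyy fam (lpos b) (rpos b), Qyy fam (lpos a) (rpos a)).
apply: (TB); last exact: (Pser_transport T1 TB TM TS TV e_gt1 q_prim c c' nl nr nl' nr' Ul Ur).
apply: (TM); last exact: (Qser_transport T1 TB TM TS TV e_gt1 q_prim c c' nl nr nl' nr' Ul Ur).
exact: Up.
Qed.

(** The gliding word [p0] carries psi_a to psi_b by construction; as neither its permutation nor its
    product on e(t) depends on the sorting word, the conclusion passes to p. *)
Lemma psi_word_series (t : word) p a : down t p -> t (lpos a) = t (rpos a) ->
  exists b, [/\ wperm (rev p) (lpos a) = lpos b, wperm (rev p) (rpos a) = rpos b
    & forall k k' : ffK, k' (lpos b) = k (lpos a) -> k' (rpos b) = k (rpos a) ->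
      BK_g b k' * (psi_word (rev p) * et t) = psi_word (rev p) * et t * BK_g a k].
Proof.
move=> dp ta; have [p0 [b [dp0 gl0]]] := glide_exists ta.
have [wl wr] := glide_wperm gl0.
have wp : wperm (rev p) = wperm (rev p0) by rewrite !wperm_rev (wperm_down dp dp0).
have up := psi_word_unique fam dp dp0.
exists b; rewrite wp; split=> // k k' kl kr; rewrite up.
apply: BK_g_intertwine => //; rewrite -?wl -?wr; try exact: (psi_word_y fam).
rewrite (psi_word_glide fam gl0 dp0 ta) (colour_idem_psi fam) mulrA.
congr (_ * et _ * _); apply/ffunP => i; rewrite pact_sadjE /sadj.
by case: tpermP => [->|->|].
Qed.

(** This computes the off-diagonal entries. If a is an ascent of t, then [a :: p] sorts s_a t and
    psi_a^2 e(t) = e(t) is inserted; if a is a descent, [a :: r] sorts t for every r sorting s_a t.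
    Uniqueness compares the result with the given words. *)
Lemma psi_word_step (t : word) p p' a (k : ffK) : down t p -> down (pact (sadj a) t) p' ->
  t (lpos a) != t (rpos a) -> colour k = t ->
  psi_word p' * psi_word (rev p) * e_ k = psi a * e_ k.
Proof.
set t' := pact (sadj a) t => dp dp' ne kt.
have ek : e_ k = et t * e_ k by rewrite (colour_idem_e fam) kt eqxx.
suff [r dr h] : exists2 r, down t' r &
    psi_word (rev p) * et t = psi_word (rev r) * et t' * psi a.
  rewrite ek !mulrA -[_ * et t]mulrA h (psi_word_unique fam dr dp') mulrA.
  by rewrite (psi_word_inv fam dp') -(colour_idem_psi fam).
have [ta|ta|/val_inj/eqP] := ltngtP (t (lpos a)) (t (rpos a)); last by rewrite (negbTE ne).
- exists (a :: p).
    by rewrite /= pact_sadjK dp andbT !pact_sadjE /sadj tpermL tpermR.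
  rewrite psi_word_rev -!mulrA -[et t' * _](colour_idem_psi fam) -[in LHS](psi_sq_colour fam ne).
  by rewrite !mulrA.
have [r dr] := down_exists t'; exists r => //.
have dar : down t (a :: r) by rewrite /= ta.
by rewrite (psi_word_unique fam dp dar) psi_word_rev -!mulrA (colour_idem_psi fam).
Qed.

Variables (T : dcomp d n -> pzAlgType F) (iota : forall l, T l -> H).
Arguments iota {l}.
Hypotheses (iotaM : forall l, {morph (@iota l) : u v / u * v})
  (iotaZ : forall l (c : F) (v : T l), iota (c%:S * v) = c%:S * iota v)
  (iota1 : forall l, @iota l 1 = et (tlam l)).
Variable red : 'S_n -> seq 'I_n.-1.
Hypothesis redP : forall w, reduced_word w (red w).
Local Notation MT := (dsum (fun l : dcomp d n => 'M[T l]_#|Jset l|)).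
Variable Phi : MT -> H.
Hypothesis PhiD : {morph Phi : u v / u + v}.
Hypothesis PhiE : forall l (v : T l) t' t, t' \in Jset l -> t \in Jset l ->
  Phi (dsum_in (A := fun l => 'M[T l]_#|Jset l|) (Emx l v t' t)) =
  psi_word (red (pi_ l t')^-1%g) * iota v * psi_word (red (pi_ l t)).

Lemma psi_red_e w k : psi_word (red w) * e_ k = e_ (pact w k) * psi_word (red w).
Proof. by have := psi_word_e fam (rev (red w)) k; rewrite revK (redP w).1. Qed.

Lemma psi_red_idem l t : t \in Jset l ->
  psi_word (red (pi_ l t)) * et t = et (tlam l) * psi_word (red (pi_ l t)).
Proof.
move=> /pi_P [wt _]; have := psi_word_idem fam (rev (red (pi_ l t))) t.
by rewrite revK (redP _).1 wt.
Qed.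

Lemma dsum_sumE (I : Type) (r : seq I) (P : pred I) (f : I -> MT) l :
  (\sum_(i <- r | P i) f i) l = \sum_(i <- r | P i) f i l.
Proof. exact: (big_morph (fun u : MT => u l)). Qed.

Lemma dsum_in_eval l l' (M : 'M[T l]_#|Jset l|) : l != l' ->
  dsum_in (A := fun l => 'M[T l]_#|Jset l|) M l' = 0.
Proof. by move=> ll'; rewrite /dsum_in eqtype.dfwith_out. Qed.

Lemma Phi0 : Phi 0 = 0.
Proof. by apply: (addrI (Phi 0)); rewrite -PhiD !addr0. Qed.

(** s t is the row of the only entry allowed in column t. Columns other than the colour word of k
    are annihilated by e(k), and since a colour word belongs to a single composition, only one block
    contributes. *)
Lemma Phi_column (v : MT) (c : forall l, word -> T l) (s : word -> word) :
  (forall l t, (s t \in Jset l) = (t \in Jset l)) ->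
  (forall l, v l = \sum_(t in Jset l) Emx l (c l t) (s t) t) ->
  forall l k, colour k \in Jset l ->
  Phi v * e_ k = psi_word (red (pi_ l (s (colour k)))^-1%g) * iota (c l (colour k))
    * psi_word (red (pi_ l (colour k))) * e_ k.
Proof.
move=> sJ vE l k kJ; pose u l' t : MT :=
  dsum_in (A := fun l => 'M[T l]_#|Jset l|) (Emx l' (c l' t) (s t) t).
have -> : v = \sum_l' \sum_(t in Jset l') u l' t.
  apply: functional_extensionality_dep => l0; rewrite dsum_sumE (bigD1 l0)//= [X in _ + X]big1.
    rewrite addr0 dsum_sumE vE; apply: eq_bigr => t _.
    by rewrite /u /dsum_in eqtype.dfwith_in.
  move=> l' l'0; rewrite dsum_sumE big1// => t _; exact: dsum_in_eval.
rewrite (big_morph Phi PhiD Phi0) mulr_suml.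
have term l' t : t \in Jset l' -> Phi (u l' t) * e_ k =
    if t == colour k then psi_word (red (pi_ l' (s t))^-1%g) * iota (c l' t)
      * psi_word (red (pi_ l' t)) * e_ k else 0.
  move=> tJ; rewrite /u PhiE ?sJ//; case: ifPn => // tk.
  (* Writing the entry as itself times 1 produces e(t^lambda), which becomes e(t) once moved to the
     right of psi_{pi_t} and is orthogonal to e(k). *)
  rewrite -[c l' t]mulr1 iotaM iota1 -!mulrA.
  have -> : et (tlam l') * (psi_word (red (pi_ l' t)) * e_ k) = 0; last by rewrite !mulr0.
  rewrite mulrA -(psi_red_idem tJ) -mulrA.
  by rewrite (colour_idem_e fam) eq_sym (negbTE tk) mulr0.
rewrite (bigD1 l)//= (big_morph Phi PhiD Phi0) mulr_suml (bigD1 (colour k))//= term// eqxx.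
rewrite big1 ?addr0 => [|t /andP[tJ tk]]; last by rewrite term// (negbTE tk).
rewrite big1 ?addr0// => l' l'l; rewrite (big_morph Phi PhiD Phi0) mulr_suml big1// => t tJ.
rewrite term//; case: eqP => // tk; move: l'l; rewrite tk in tJ.
by rewrite (Jset_inj tJ kJ) eqxx.
Qed.

(** The image x of a matrix entry is known only on idempotents of colour t^lambda. psi_{pi_t}
    carries e(k) to such an idempotent, where x may be replaced by an element X of H that psi_{pi_t}
    intertwines with Z. *)
Lemma Phi_diag l (k : ffK) (x X Z : H) : colour k \in Jset l ->
  x * e_ (pact (pi_ l (colour k)) k) = X * e_ (pact (pi_ l (colour k)) k) ->
  X * (psi_word (red (pi_ l (colour k))) * et (colour k)) =
    psi_word (red (pi_ l (colour k))) * et (colour k) * Z ->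
  psi_word (red (pi_ l (colour k))^-1%g) * x * psi_word (red (pi_ l (colour k))) * e_ k
  = et (colour k) * (Z * e_ k).
Proof.
move=> kJ xX XZ; set t := colour k in kJ xX XZ *.
have dt := reduced_pi_down kJ (redP (pi_ l t)).
have dt' := reduced_piV_down kJ (redP (pi_ l t)^-1%g).
have pk := psi_red_e (pi_ l t) k.
rewrite -mulrA pk -!mulrA [x * _]mulrA xX -mulrA -pk !mulrA -[RHS]mulrA.
have := psi_word_conj fam dt dt' (erefl : colour k = t) (x := X) (z := Z).
by rewrite revK; exact.
Qed.

Lemma colour_idem_id (k : ffK) (x : H) : (forall t, GRing.comm x (et t)) ->
  et (colour k) * (x * e_ k) = x * e_ k.
Proof. by move=> c; rewrite mulrA -c -mulrA (colour_idem_e fam) eqxx. Qed.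

Lemma pact_colour l (k : ffK) : colour k \in Jset l ->
  colour (pact (pi_ l (colour k)) k) = tlam l.
Proof. by move=> kJ; rewrite colour_pact; exact: (pi_P kJ).1. Qed.

Lemma Phi_t (v : MT) (f : 'I_d -> F) (a : 'I_n) :
  (forall l, v l = \sum_(t in Jset l) Emx l (f (t a))%:S t t) ->
  forall k, Phi v * e_ k = (f (k a).2)%:S * e_ k.
Proof.
move=> vE k; have [l kJ] := Jset_exists (colour k).
rewrite (Phi_column (c := fun l t => (f (t a))%:S) (s := id) _ vE kJ)//=.
rewrite (@Phi_diag l k _ (f (k a).2)%:S (f (k a).2)%:S)//.
- by apply: colour_idem_id => t; exact: scalC.
- rewrite -[X in iota X]mulr1 iotaZ iota1 -mulrA (colour_idem_e fam) pact_colour// eqxx.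
  by rewrite ffunE.
- exact: scalC.
Qed.

Lemma Phi_X (v : MT) (X : forall l, 'I_n -> T l) (a : 'I_n) :
  (forall l b (k : ffK), colour k = tlam l ->
     iota (X l b) * e_ k = (q ^+ (k b).1)%:S * (1 - y b) * e_ k) ->
  (forall l, v l = \sum_(t in Jset l) Emx l (X l (pi_ l t a)) t t) ->
  forall k, Phi v * e_ k = (q ^+ (k a).1)%:S * (1 - y a) * e_ k.
Proof.
move=> XE vE k; have [l kJ] := Jset_exists (colour k).
rewrite (Phi_column (c := fun l t => X l (pi_ l t a)) (s := id) _ vE kJ)//=.
have dt := reduced_pi_down kJ (redP (pi_ l (colour k))).
set b := pi_ l (colour k) a.
rewrite (@Phi_diag l k _ ((q ^+ (k a).1)%:S * (1 - y b)) ((q ^+ (k a).1)%:S * (1 - y a)))//.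
- apply: colour_idem_id => t; apply: commr_sym; apply: commrM.
    exact/commr_sym/comm_scal.
  by apply: commrB; [exact: commr1 | apply/esym/(colour_idem_y fam)].
- by rewrite XE ?pact_colour// ffunE permK.
rewrite -mulrA [RHS]mulrA -scalC -[RHS]mulrA; congr (_ * _).
rewrite mulrBl mulrBr mul1r mulr1; congr (_ - _).
by have := psi_word_y fam a dt; rewrite revK (redP _).1.
Qed.

Lemma Phi_g (v : MT) (G : forall l, 'I_n -> T l) (a : 'I_n.-1) :
  (forall l b (k : ffK), colour k = tlam l -> tlam l (lpos b) = tlam l (rpos b) ->
     iota (G l (lpos b)) * e_ k = BK_g b k * e_ k) ->
  (forall l, v l =
     \sum_(t in Jset l | t (lpos a) == t (rpos a)) Emx l (G l (pi_ l t (lpos a))) t t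
     + \sum_(t in Jset l | t (lpos a) != t (rpos a)) Emx l sq%:S t (pact (sadj a) t)) ->
  forall k, Phi v * e_ k =
    (psi a * QserK q sq (k (lpos a)) (k (rpos a)) (y (lpos a)) (y (rpos a))
     - PserK q (k (lpos a)) (k (rpos a)) (y (lpos a)) (y (rpos a))) * e_ k.
Proof.
move=> GE vE k; have [l kJ] := Jset_exists (colour k).
pose c l (t : word) : T l :=
  if t (lpos a) == t (rpos a) then G l (pi_ l t (lpos a)) else sq%:S.
pose s (t : word) := if t (lpos a) == t (rpos a) then t else pact (sadj a) t.
have sJ l' t : (s t \in Jset l') = (t \in Jset l').
  by rewrite /s; case: ifP => // _; rewrite pact_Jset.
have vE' l' : v l' = \sum_(t in Jset l') Emx l' (c l' t) (s t) t.
  rewrite vE [RHS](bigID (fun t : word => t (lpos a) == t (rpos a))) /=; congr (_ + _).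
    by apply: eq_bigr => t /andP[_ ta]; rewrite /c /s ta.
  (* JPA lists its off-diagonal entries by their rows, [Phi_column] by columns; t -> s_a t passes
     from one to the other. *)
  rewrite (reindex_inj (inv_inj (@pact_sadjK _ n a))) /=; apply: eq_big => t.
    by rewrite pact_Jset !pact_sadjE /sadj tpermL tpermR [in X in _ && X]eq_sym.
  rewrite !pact_sadjE /sadj tpermL tpermR [in X in _ && X]eq_sym => /andP[_ ta].
  by rewrite /c /s (negbTE ta) -/(sadj a) pact_sadjK.
rewrite (Phi_column sJ vE' kJ) /c /s /QserK /PserK !ffunE -!/(colour k).
(* For two different colours the entry is central, and the product of the words for t and s_a t
   reduces to psi_a. *)
case: ifPn => ta; last first.
  rewrite -[X in iota X]mulr1 iotaZ iota1 subr0.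
  have dt := reduced_pi_down kJ (redP (pi_ l (colour k))).
  have kJ' : pact (sadj a) (colour k) \in Jset l by rewrite pact_Jset.
  have dt' := reduced_piV_down kJ' (redP (pi_ l (pact (sadj a) (colour k)))^-1%g).
  have ne : colour k (lpos a) != colour k (rpos a) by rewrite !ffunE.
  have := psi_word_step dt dt' ne erefl; rewrite revK => st.
  have ek : et (tlam l) * (psi_word (red (pi_ l (colour k))) * e_ k)
      = psi_word (red (pi_ l (colour k))) * e_ k.
    by rewrite mulrA -(psi_red_idem kJ) -mulrA (colour_idem_e fam) eqxx.
  by rewrite -!mulrA ek [LHS]mulrA -scalC -mulrA [psi_word _ * _]mulrA st !mulrA scalC.
have ta' : colour k (lpos a) = colour k (rpos a) by rewrite !ffunE; exact/eqP.
have dt := reduced_pi_down kJ (redP (pi_ l (colour k))).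
have [b [bl br bS]] := psi_word_series dt ta'.
rewrite (pi_down kJ dt) in bl br.
have kl : pact (pi_ l (colour k)) k (lpos b) = k (lpos a) by rewrite -bl ffunE permK.
have kr : pact (pi_ l (colour k)) k (rpos b) = k (rpos a) by rewrite -br ffunE permK.
rewrite bl (@Phi_diag l k _ (BK_g b (pact (pi_ l (colour k)) k)) (BK_g a k))//.
- have E : BK_g a k * et (colour k) = et (colour k) * BK_g a k.
    apply: BK_g_intertwine => //; try exact: (colour_idem_y fam).
    rewrite (colour_idem_psi fam); congr (et _ * _); apply/ffunP => i.
    by rewrite pact_sadjE /sadj; case: tpermP => [->|->|].
  by rewrite mulrA -E -mulrA (colour_idem_e fam) eqxx.
- apply: GE; first exact: pact_colour.
  by rewrite -(pact_colour kJ) [LHS]ffunE [RHS]ffunE kl kr; exact/eqP.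
- by move: (bS _ _ kl kr); rewrite revK.
Qed.
End Assembly.

(** * Comparison on generators *)

Section Generation.
Variables (F : fieldType) (G : choiceType) (r : falg F G -> falg F G -> Prop).

Lemma malg_fmonom (s : seq G) : << monalg.FMonom s >> = \prod_(g <- s) fgen F g :> falg F G.
Proof.
elim: s => [|g s IH]; first by rewrite big_nil -fmoneE.
rewrite big_cons -IH /fgen [RHS]malgM_def fgmulUU mulr1; congr << _ >>.
by apply: val_inj; rewrite /= fmM fmU.
Qed.

(** An element is lifted to the free algebra and expanded there into scalars times products of
    generators. *)
Lemma palg_ind (P : palg r -> Prop) :
  (forall x y, P x -> P y -> P (x + y)) -> (forall x y, P x -> P y -> P (x * y)) ->
  (forall c : F, P c%:S) -> (forall g, P (pgen r g)) -> forall x, P x.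
Proof.
move=> PD PM PS Pg x; rewrite -(pliftK x) [plift x]monalgE raddf_sum /=.
have P0 : P 0 by rewrite -[0](raddf0 (@scal F (palg r))); exact: PS.
have P1 : P 1 by rewrite -[1](rmorph1 (@scal F (palg r))); exact: PS.
apply: (big_ind P) => // -[s] _.
have -> : << (plift x)@_(monalg.FMonom s) *g monalg.FMonom s >>
    = ((plift x)@_(monalg.FMonom s) *: 1) * << monalg.FMonom s >> :> falg F G.
  by rewrite -scalerAl mul1r; apply/malgP => k; rewrite mcoeffZ !mcoeffU mulrnAr mulr1.
rewrite rmorphM; apply: (PM); first exact: PS.
rewrite malg_fmonom rmorph_prod.
by apply: (big_ind P) => [|u v|g _]; [exact: P1 | exact: PM | exact: Pg].
Qed.

(** The middle map h stands for [BKmap], which is a bare function; its compatibility with the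
    operations is therefore taken as hypotheses. *)
Lemma palg_hom_eq (B C D : pzAlgType F) (f : {alghom palg r -> B})
    (g : {alghom palg r -> C}) (h : C -> D) (k : {alghom D -> B}) :
  {morph h : u v / u + v} -> {morph h : u v / u * v} ->
  (forall c : F, h c%:S = c%:S) ->
  (forall a, f (pgen r a) = k (h (g (pgen r a)))) -> forall x, f x = k (h (g x)).
Proof.
move=> hD hM hS hg; apply: palg_ind => // [x y|x y|c].
- move=> hx hy; rewrite (rmorphD g) hD.
  apply: etrans (rmorphD f x y) (etrans _ (esym (rmorphD k _ _))).
  by congr (_ + _); [exact: hx | exact: hy].
- move=> hx hy; rewrite (rmorphM g) hM.
  apply: etrans (rmorphM f x y) (etrans _ (esym (rmorphM k _ _))).
  by congr (_ * _); [exact: hx | exact: hy].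
- by rewrite !algh_scal hS algh_scal.
Qed.
End Generation.

Section EntrywiseMap.
Variables (F : fieldType) (I : finType) (m : I -> nat) (T T' : I -> pzAlgType F).
Variable f : forall i, {alghom T i -> T' i}.
Local Notation MT := (dsum (fun i => 'M[T i]_(m i))).
Local Notation MT' := (dsum (fun i => 'M[T' i]_(m i))).

Definition dsum_map_mx (M : MT) : MT' := fun i => map_mx (f i) (M i).

Lemma dsum_map_mxD : {morph dsum_map_mx : u v / u + v}.
Proof.
move=> u v; apply: functional_extensionality_dep => i; apply/matrixP => a b.
by rewrite !mxE rmorphD.
Qed.

Lemma dsum_map_mxM : {morph dsum_map_mx : u v / u * v}.
Proof.
move=> u v; apply: functional_extensionality_dep => i; apply/matrixP => a b.
by rewrite !mxE rmorph_sum; apply: eq_bigr => c _; rewrite !mxE rmorphM.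
Qed.

Lemma dsum_map_mxS (c : F) : dsum_map_mx c%:S = c%:S.
Proof.
apply: functional_extensionality_dep => i; apply/matrixP => a b.
by rewrite !mxE rmorphMn; congr (_ *+ _); exact: algh_scal.
Qed.
End EntrywiseMap.

Lemma map_Emx (F : fieldType) (d n : nat) (l : dcomp d n) (A B : pzAlgType F)
    (f : {alghom A -> B}) (v : A) t' t :
  map_mx f (Emx l v t' t) = Emx l (f v) t' t.
Proof. by apply/matrixP => a b; rewrite !mxE; case: ifP => // _; rewrite rmorph0. Qed.

Lemma map_mx_sum (F : fieldType) (m m' : nat) (A B : pzAlgType F)
    (f : {alghom A -> B}) (I : Type) (r : seq I) (P : pred I) (M : I -> 'M[A]_(m, m')) :
  map_mx f (\sum_(i <- r | P i) M i) = \sum_(i <- r | P i) map_mx f (M i).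
Proof.
apply/matrixP => a b; rewrite mxE !summxE rmorph_sum.
by apply: eq_bigr => i _; rewrite mxE.
Qed.

Lemma tmap_in (F : fieldType) (J : choiceType) (A B : J -> pzAlgType F)
    (f : forall j, {alghom A j -> B j}) j (a : A j) :
  tmap f (tens_in a) = tens_in (f j a).
Proof.
rewrite [LHS]tmap_tens tmap_pset.
have f1 : (fun i => f i 1 : B i) = (fun=> 1) :> pure B.
  by apply: functional_extensionality_dep => i; exact: rmorph1.
exact: (congr1 (fun x : pure B => tens (pset x (f j a))) f1).
Qed.

Lemma sum_Qe_mul (V : finType) (edge : rel V) (L : V -> nat) (m : nat) (H : pzRingType)
    (e_ : {ffun 'I_m -> V} -> H) y psi (f : {ffun 'I_m -> V} -> H) k :
  quiver_family edge L e_ y psi -> (\sum_k' f k' * e_ k') * e_ k = f k * e_ k.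
Proof.
move=> fam; rewrite mulr_suml (bigD1 k)//= -mulrA (Qe_mul fam) eqxx big1 ?addr0// => k' k'k.
by rewrite -mulrA (Qe_mul fam) (negbTE k'k) mulr0.
Qed.

Section BlockGenerators.
Variables (F : fieldType) (e d n : nat) (q : F) (L : 'Z_e -> nat) (l : dcomp d n).
Local Notation K := ('Z_e * 'I_d)%type.
Local Notation ffK := {ffun 'I_n -> K}.
Variables (H : pzAlgType F) (e_ : ffK -> H) (y : 'I_n -> H) (psi : 'I_n.-1 -> H).
Hypothesis fam : quiver_family (@edge_K e d) (fun k => L k.1) e_ y psi.
Variables (A : 'I_d -> pzAlgType F).
Variables (eA : forall j, {ffun 'I_(part l j) -> 'Z_e} -> A j)
  (yA : forall j, 'I_(part l j) -> A j) (psiA : forall j, 'I_(part l j).-1 -> A j).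
Arguments eA {j}.
Arguments yA {j}.
Arguments psiA {j}.
Hypothesis famA : forall j, quiver_family (@edge_e e) L (@eA j) (@yA j) (@psiA j).
Variable iota : tensor A -> H.
Local Notation eps := (colour_idem e_ (tlam l)).
Hypotheses (iotaD : {morph iota : u v / u + v}) (iotaM : {morph iota : u v / u * v})
  (iotaZ : forall (c : F) v, iota (c%:S * v) = c%:S * iota v).
Hypothesis iota_y : forall (j : 'I_d) (b : 'I_(part l j)) (a : 'I_n),
  a = (offset l j + b)%N :> nat -> iota (tens_in (yA b)) = y a * eps.
Hypothesis iota_psi : forall (j : 'I_d) (b : 'I_(part l j).-1) (a : 'I_n.-1),
  a = (offset l j + b)%N :> nat -> iota (tens_in (psiA b)) = psi a * eps.
Hypothesis iota_e : forall (k_ : forall j : 'I_d, {ffun 'I_(part l j) -> 'Z_e}) (k : ffK),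
  (forall j (b : 'I_(part l j)) (a : 'I_n),
     a = (offset l j + b)%N :> nat -> k a = (k_ j b, j)) ->
  iota (tens (fun j => eA (k_ j))) = e_ k.
Hypotheses (e_gt1 : (1 < e)%N) (q_prim : e.-primitive_root q).
Variables (Y : 'I_d -> pzAlgType F) (f : forall j, {alghom Y j -> A j})
  (gY XY : forall j, nat -> Y j).
Hypothesis f_g : forall j (b : 'I_(part l j).-1), f j (gY j b) =
  \sum_(k' : {ffun 'I_(part l j) -> 'Z_e})
     (psiA b * Qser q (k' (lpos b)) (k' (rpos b)) (yA (lpos b)) (yA (rpos b))
      - Pser q (k' (lpos b)) (k' (rpos b)) (yA (lpos b)) (yA (rpos b))) * eA k'.
Hypothesis f_X : forall j (b : 'I_(part l j)), f j (XY j b) =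
  \sum_(k' : {ffun 'I_(part l j) -> 'Z_e}) (q ^+ k' b)%:S * (1 - yA b) * eA k'.

Lemma block_g (b : 'I_n.-1) (k : ffK) : colour k = tlam l ->
  tlam l (lpos b) = tlam l (rpos b) ->
  iota (tmap f (tens_in (gY (tlam l (lpos b)) (lpos b - offset l (tlam l (lpos b)))))) * e_ k
  = BK_g q y psi b k * e_ k.
Proof.
move=> kl tb; rewrite tmap_in; set j := tlam l (lpos b).
have := tlam_block l (lpos b); have := tlam_block l (rpos b); rewrite -tb -/j /= => h1 h2.
(* Both b and b + 1 lie in block j, so the shifted index is that of a simple transposition inside
   the block. *)
have bj : (b - offset l j < (part l j).-1)%N by lia.
rewrite -[(b - offset l j)%N]/(nat_of_ord (Ordinal bj)) f_g.
apply: (corner_BK_g (phi := iota_in iota (j := j)) fam (famA j)) => //.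
- exact: iota_inM.
- exact: iota_inB.
- exact: (iota_in1 famA).
- exact: (iota_in_scal famA).
- exact: (iota_in_e famA).
- exact: iota_in_y.
- exact: iota_in_psi.
- by rewrite /=; lia.
Qed.

Lemma block_X (b : 'I_n) (k : ffK) : colour k = tlam l ->
  iota (tmap f (tens_in (XY (tlam l b) (b - offset l (tlam l b))))) * e_ k
  = (q ^+ (k b).1)%:S * (1 - y b) * e_ k.
Proof.
move=> kl; rewrite tmap_in; set j := tlam l b.
have := tlam_block l b; rewrite -/j => h.
have bj : (b - offset l j < part l j)%N by lia.
rewrite -[(b - offset l j)%N]/(nat_of_ord (Ordinal bj)) f_X.
apply: (corner_BK_X q (phi := iota_in iota (j := j)) fam (famA j)) => //.
- exact: iota_inM.
- exact: iota_inB.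
- exact: (iota_in1 famA).
- exact: (iota_in_scal famA).
- exact: (iota_in_e famA).
- exact: iota_in_y.
- by rewrite /=; lia.
Qed.
End BlockGenerators.

Section Comparison.
Variables (F : fieldType) (d n e : nat) (xi q sq : F) (L : 'Z_e -> nat).
Variables (red : 'S_n -> seq 'I_n.-1) (BKt : {alghom Yok q L d n -> HK F L d n})
  (JPA : {alghom Yok q L d n -> MatHecke q L d n})
  (bk : forall m, {alghom Hecke q L m -> HI F L m})
  (iota : forall l : dcomp d n, HI_l F L l -> HK F L d n)
  (Phi : {alghom MatHI F L d n -> HK F L d n}).
Arguments iota : clear implicits.
Hypotheses (e_gt1 : (1 < e)%N) (q_prim : e.-primitive_root q).
Hypothesis redP : forall w, reduced_word w (red w).
Hypothesis bkP : forall m, is_BK (bk m).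
Hypothesis iotaP : forall l, is_corner_embedding (iota l).
Hypothesis PhiP : is_Phi red iota Phi.

Local Notation e_ := (@Qe F _ (@edge_K e d) (fun k => L k.1) n).
Local Notation y := (@Qy F _ (@edge_K e d) (fun k => L k.1) n).
Local Notation psi := (@Qpsi F _ (@edge_K e d) (fun k => L k.1) n).

Let famK : @quiver_family _ (@edge_K e d) (fun k => L k.1) n (HK F L d n) e_ y psi.
Proof. exact: QHecke_family. Qed.
Let famI m : @quiver_family _ (@edge_e e) L m (HI F L m)
  (@Qe F _ (@edge_e e) L m) (@Qy F _ (@edge_e e) L m) (@Qpsi F _ (@edge_e e) L m).
Proof. exact: QHecke_family. Qed.

Let iotaD l : {morph iota l : u v / u + v}. Proof. by case: (iotaP l) => -[]. Qed.
Let iotaM l : {morph iota l : u v / u * v}. Proof. by case: (iotaP l) => -[]. Qed.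
Let iotaZ l (c : F) v : iota l (c%:S * v) = c%:S * iota l v.
Proof. by case: (iotaP l) => -[]. Qed.
Let iota1 l : iota l 1 = colour_idem e_ (tlam l).
Proof.
case: (iotaP l) => _ [_ _ he]; exact: (iota1 (fun j => famI (part l j)) (@iotaD l) he).
Qed.
Let PhiD : {morph Phi : u v / u + v}. Proof. exact: rmorphD. Qed.

Let f (l : dcomp d n) := tmap (fun j => bk (part l j)).

Lemma BKmap_gl l (b : 'I_n.-1) (k : {ffun 'I_n -> 'Z_e * 'I_d}) : colour k = tlam l ->
  tlam l (lpos b) = tlam l (rpos b) ->
  iota l (f l (gl q L l (lpos b))) * e_ k = BK_g q y psi b k * e_ k.
Proof.
case: (iotaP l) => _ [hy hp he] kl tb.
have fg j (b' : 'I_(part l j).-1) : bk (part l j) (Yg_ q L 1 (part l j) b') =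
    \sum_(k' : {ffun 'I_(part l j) -> 'Z_e})
      (Qpsi F (@edge_e e) L b'
       * Qser q (k' (lpos b')) (k' (rpos b'))
           (Qy F (@edge_e e) L (lpos b')) (Qy F (@edge_e e) L (rpos b'))
       - Pser q (k' (lpos b')) (k' (rpos b'))
           (Qy F (@edge_e e) L (lpos b')) (Qy F (@edge_e e) L (rpos b')))
      * Qe F (@edge_e e) L k'.
  (* The index is in range, so [Yg_] returns a generator and not its default value 0. *)
  by have [hg _] := bkP (part l j); rewrite -hg; congr (bk _ _); rewrite /Yg_ valK.
exact: (block_g famK (fun j => famI (part l j)) (@iotaD l) (@iotaM l) (@iotaZ l) hy hp he
  e_gt1 q_prim (f := fun j => bk (part l j)) (gY := fun j => Yg_ q L 1 (part l j)) fg kl tb).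
Qed.

Lemma BKmap_Xl l (b : 'I_n) (k : {ffun 'I_n -> 'Z_e * 'I_d}) : colour k = tlam l ->
  iota l (f l (Xl q L l b)) * e_ k = (q ^+ (k b).1)%:S * (1 - y b) * e_ k.
Proof.
case: (iotaP l) => _ [hy hp he].
apply: (block_X famK (fun j => famI (part l j)) (@iotaD l) (@iotaM l) (@iotaZ l) hy he
  e_gt1 q_prim (f := fun j => bk (part l j)) (XY := fun j => YX q L 1 (part l j))).
by move=> j b'; have [_ hX] := bkP (part l j); exact: hX.
Qed.

Lemma BKmap_entry (M : MatHecke q L d n) l (P : pred {ffun 'I_n -> 'I_d})
    (c : {ffun 'I_n -> 'I_d} -> Hecke_l q L l) s1 s2 :
  M l = \sum_(t | P t) Emx l (c t) (s1 t) (s2 t) ->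
  BKmap bk M l = \sum_(t | P t) Emx l (f l (c t)) (s1 t) (s2 t).
Proof.
move=> Ml; rewrite /BKmap Ml (map_mx_sum (f l)); apply: eq_bigr => t _.
exact: (map_Emx l (f l)).
Qed.

Hypotheses (BKtP : is_BKtilde sq xi BKt) (JPAP : is_JPA sq xi JPA).

Lemma comparison_g (a : 'I_n.-1) : BKt (Yg q L d a) = Phi (BKmap bk (JPA (Yg q L d a))).
Proof.
case: BKtP JPAP => [hB _ _] [_ _ hJ]; apply: (eq_Qe famK) => k; rewrite hB.
apply: etrans (sum_Qe_mul _ k famK) _; apply/esym.
apply: (Phi_g famK e_gt1 q_prim iotaM iotaZ iota1 redP PhiD PhiP
  (G := fun l b => f l (gl q L l b))) => [l b k' kl tb|l]; first exact: BKmap_gl.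
rewrite /BKmap hJ; apply: etrans (map_mxD _ _ _) _.
by congr (_ + _); rewrite (map_mx_sum (f l)); apply: eq_bigr => t _;
  rewrite (map_Emx l (f l)) ?algh_scal.
Qed.

Lemma comparison_t (a : 'I_n) : BKt (Yt q L d a) = Phi (BKmap bk (JPA (Yt q L d a))).
Proof.
case: BKtP JPAP => [_ hB _] [hJ _ _]; apply: (eq_Qe famK) => k; rewrite hB.
apply: etrans (sum_Qe_mul _ k famK) _; apply/esym.
apply: (Phi_t famK iotaM iotaZ iota1 redP PhiD PhiP (f := fun j => xi ^+ j.+1)) => l.
rewrite (BKmap_entry (hJ a l)); apply: eq_bigr => t _.
by congr (Emx l _ t t); exact: algh_scal.
Qed.

Lemma comparison_X (a : 'I_n) :
  BKt (YX q L d n a) = Phi (BKmap bk (JPA (YX q L d n a))).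
Proof.
case: BKtP JPAP => [_ _ hB] [_ hJ _]; apply: (eq_Qe famK) => k; rewrite hB.
apply: etrans (sum_Qe_mul _ k famK) _; apply/esym.
apply: (Phi_X famK iotaM iota1 redP PhiD PhiP
  (X := fun l b => f l (Xl q L l b))) => [l b k' kl|l]; first exact: BKmap_Xl.
exact: (BKmap_entry (hJ a l)).
Qed.

Lemma comparison x : BKt x = Phi (BKmap bk (JPA x)).
Proof.
apply: palg_hom_eq.
- exact: (dsum_map_mxD f).
- exact: (dsum_map_mxM f).
- exact: (dsum_map_mxS (fun l => #|Jset l|) f).
case=> [a|b|h]; [exact: comparison_g|exact: comparison_t|].
(* X_1 is [YX] at index 0, defined by matching on [idP]. The reflection proof is generalised before
   being destructed, and the two proofs of 0 < n are identified by irrelevance. *)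
have -> : pgen (@yrel F e q L d n) (GenX1 h) = YX q L d n (Ordinal h).
  suff X1E b (p : reflect (0 < n)%N b) : b -> pgen (@yrel F e q L d n) (GenX1 h) =
      match p with ReflectT h' => pgen (@yrel F e q L d n) (GenX1 h') | ReflectF _ => 0 end.
    exact: X1E.
  by case: p => // h' _; congr (pgen _ (GenX1 _)); exact: bool_irrelevance.
exact: comparison_X.
Qed.
End Comparison.

Theorem theorem6p34 (R : realType) (d n e : nat) (xi q sq : R[i])
    (L : 'Z_e -> nat)
    (red : 'S_n -> seq 'I_n.-1)
    (BKt : {alghom Yok q L d n -> HK R[i] L d n})
    (JPA : {alghom Yok q L d n -> MatHecke q L d n})
    (bk : forall m, {alghom Hecke q L m -> HI R[i] L m})
    (iota : forall l : dcomp d n, HI_l R[i] L l -> HK R[i] L d n)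
    (Phi : {alghom MatHI R[i] L d n -> HK R[i] L d n}) :
  (0 < d)%N -> (0 < n)%N -> (1 < e)%N ->
  d.-primitive_root xi -> e.-primitive_root q -> sq ^+ 2 = q ->
  (exists i, L i != 0%N) ->
  (forall w, reduced_word w (red w)) ->
  is_BKtilde sq xi BKt ->
  is_JPA sq xi JPA ->
  (forall m, is_BK (bk m)) ->
  (forall l, is_corner_embedding (iota l)) ->
  is_Phi red iota Phi ->
  forall x : Yok q L d n, BKt x = Phi (BKmap bk (JPA x)).
Proof.
move=> _ _ e_gt1 _ q_prim _ _ redP BKtP JPAP bkP iotaP PhiP.
exact: (comparison e_gt1 q_prim redP bkP iotaP PhiP BKtP JPAP).
Qed.
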